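(* Let $\mathbf q(x,t)$ be a solution of the defocusing-defocusing coupled Hirota equations satisfying the boundary conditions $\lim_{x\to\pm\infty}\mathbf q(x,t)=\mathbf q_\pm$ with $\|\mathbf q_\pm\|=q_0>0$, with $\mathbf q_+$ not parallel to $\mathbf q_-$ (i.e. $|\mathbf q_+^\dagger\mathbf q_-|<q_0^2$), and with $\mathbf q(\cdot,t)-\mathbf q_\pm\in L^1(\mathbb R)$. Then it is impossible that $\beta_1(z)=\beta_2(z)=0$ for all $z\in\mathbb R\setminus\{0,\pm q_0\}$. In other words, with non-parallel boundary conditions there are no reflectionless (pure soliton) solutions.
   Context: Fix $q_0>0$ and $\sigma\in\mathbb R$. The defocusing-defocusing coupled Hirota equations are $\mathrm i\mathbf q_t+\mathbf q_{xx}-2(\|\mathbf q\|^2-q_0^2)\mathbf q+\mathrm i\sigma[\mathbf q_{xxx}-3\|\mathbf q\|^2\mathbf q_x-3(\mathbf q^\dagger\mathbf q_x)\mathbf q]=\mathbf 0$ for $\mathbf q(x,t)=(q_1,q_2)^T\in\mathbb C^2$, with boundary conditions $\lim_{x\to\pm\infty}\mathbf q(x,t)=\mathbf q_\pm$, $\|\mathbf q_\pm\|=q_0$, in the non-parallel case $0\le|\mathbf q_+^\dagger\mathbf q_-|<q_0^2$ (called orthogonal if $\mathbf q_+^\dagger\mathbf q_-=0$, non-orthogonal otherwise). Here $\dagger$ is conjugate transpose and $^*$ complex conjugation. For $\mathbf v=(v_1,v_2)^T$ put $\mathbf v^\perp=(v_2^*,-v_1^* )^T$; $q_{\pm,\hbar}$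 denotes the $\hbar$-th component of $\mathbf q_\pm$. Lax pair: $\psi_x=\mathbf X\psi$, $\psi_t=\mathbf T\psi$, with $\mathbf J=\mathrm{diag}(1,-1,-1)$, $\mathbf Q=\begin{pmatrix}0&-\mathbf q^\dagger\\ \mathbf q&\mathbf 0_{2\times2}\end{pmatrix}$, $\mathbf X=\mathrm ik\mathbf J+\mathrm i\mathbf Q$, $\mathbf T=4\mathrm i\sigma k^3\mathbf J-\mathrm iq_0^2\mathbf J+k^2(4\mathrm i\sigma\mathbf Q+2\mathrm i\mathbf J)+k(2\mathrm i\mathbf Q-2\sigma\mathbf Q_x\mathbf J-2\mathrm i\sigma\mathbf J\mathbf Q^2)-2\mathrm i\sigma\mathbf Q^3-\mathrm i\mathbf J\mathbf Q^2-\mathrm i\sigma\mathbf Q_{xx}-\mathbf Q_x\mathbf J+\sigma[\mathbf Q,\mathbf Q_x]$. Uniformization: $k(z)=\tfrac12(z+q_0^2/z)$, $\lambda(z)=\tfrac12(z-q_0^2/z)$, $\mathbb D^\pm=\{z:\pm\operatorname{Im}z>0\}$, $\widehat\rho(z)=z^2/(z^2-q_0^2)$, and $\widehat{\mathbf Y}_\pm(z)=\widehat\rho(z)\begin{pmatrix}\mathrm i&0&q_0/z\\ \mathrm i\mathbf q_\pm/z&\mathbf q_\pm^\perp/(\widehat\rho(z)q_0)&\mathbf q_\pm/q_0\end{pmatrix}$. Put $\delta_1=\lambda x+2\lambda[k+\sigma(3k^2-\lambda^2)]t$, $\delta_2=-kx-(\lambda^2+k^2+4\sigma k^3)t$, $\mathbf\Delta=\mathrm{diag}(\delta_1,\delta_2,-\delta_1)$.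 Assume $\mathbf q(\cdot,t)-\mathbf q_\pm\in L^1(\mathbb R^\pm_x)$. The Jost solutions $\psi_\pm(z;x,t)$, $z\in\mathbb R\setminus\{0,\pm q_0\}$, are the $3\times3$ simultaneous solutions of the Lax pair with $\psi_\pm=\widehat{\mathbf Y}_\pm(z)e^{\mathrm i\mathbf\Delta(z)}+o(1)$ as $x\to\pm\infty$; the modified eigenfunctions are $\nu_\pm=\psi_\pm e^{-\mathrm i\mathbf\Delta}$; $\psi_{\pm,j},\nu_{\pm,j}$ denote $j$-th columns. The columns $\nu_{-,1},\nu_{+,3}$ extend analytically to $\mathbb D^-$ and $\nu_{-,3},\nu_{+,1}$ to $\mathbb D^+$. The scattering matrix $\mathbf H(z)=(h_{ij}(z))$ is defined by $\psi_+=\psi_-\mathbf H$ and $\mathbf S=\mathbf H^{-1}=(s_{ij})$; $\det\mathbf H=1$, $h_{11},s_{33}$ extend analytically to $\mathbb D^+$ and $s_{11},h_{33}$ to $\mathbb D^-$. Reflection coefficients on $\mathbb R\setminus\{0,\pm q_0\}$: $\beta_1=s_{13}/s_{11}$, $\beta_2=h_{21}/h_{11}$. *)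

(* Defs.v *)
From Stdlib Require Import Reals.
From Coquelicot Require Import Coquelicot.
Open Scope R_scope.

(* A vector of C^2 is a function nat -> C; only components 0,1 are used
   (component 0 = q_1, component 1 = q_2).
   A 3x3 matrix is a function nat -> nat -> C; only indices 0,1,2 are used
   (index 0 = paper's index 1, etc.). *)
Definition vec := nat -> C.
Definition mat := nat -> nat -> C.

Definition cr (r : R) : C := RtoC r.

Definition mmul (A B : mat) : mat :=
  fun i j => (A i 0%nat * B 0%nat j + A i 1%nat * B 1%nat j + A i 2%nat * B 2%nat j)%C.
Definition madd (A B : mat) : mat := fun i j => (A i j + B i j)%C.
Definition msub (A B : mat) : mat := fun i j => (A i j - B i j)%C.
Definition mscale (c : C) (A : mat) : mat := fun i j => (c * A i j)%C.
Definition mid : mat := fun i j => if Nat.eqb i j then cr 1 else cr 0.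

Definition Jm : mat := fun i j =>
  match i, j with
  | 0, 0 => cr 1
  | 1, 1 => cr (-1)
  | 2, 2 => cr (-1)
  | _, _ => cr 0
  end%nat.

Definition Qm (v : vec) : mat := fun i j =>
  match i, j with
  | 0, 1 => (- Cconj (v 0%nat))%C
  | 0, 2 => (- Cconj (v 1%nat))%C
  | 1, 0 => v 0%nat
  | 2, 0 => v 1%nat
  | _, _ => cr 0
  end%nat.

Definition nrm2 (v : vec) : R := Cmod (v 0%nat) ^ 2 + Cmod (v 1%nat) ^ 2.
Definition herm (u v : vec) : C :=
  (Cconj (u 0%nat) * v 0%nat + Cconj (u 1%nat) * v 1%nat)%C.
Definition vperp (v : vec) : vec := fun h =>
  match h with
  | 0 => Cconj (v 1%nat)
  | 1 => (- Cconj (v 0%nat))%C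
  | _ => cr 0
  end%nat.

Definition kz (q0 z : R) : R := (z + q0 ^ 2 / z) / 2.
Definition lz (q0 z : R) : R := (z - q0 ^ 2 / z) / 2.
Definition rhohat (q0 z : R) : R := z ^ 2 / (z ^ 2 - q0 ^ 2).

Definition zdom (q0 z : R) : Prop := z <> 0 /\ z <> q0 /\ z <> - q0.

Definition Xm (k : R) (v : vec) : mat :=
  madd (mscale (Ci * cr k)%C Jm) (mscale Ci (Qm v)).

Definition Tm (sigma q0 k : R) (v vx vxx : vec) : mat :=
  let Q := Qm v in
  let Qx := Qm vx in
  let Qxx := Qm vxx in
  let Q2 := mmul Q Q in
  let Q3 := mmul Q2 Q in
  let s := cr sigma in
  let kk := cr k in
  let t1 := mscale (cr 4 * Ci * s * kk * kk * kk)%C Jm in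
  let t2 := mscale (- (Ci * cr (q0 ^ 2)))%C Jm in
  let t3 := mscale (kk * kk)%C
              (madd (mscale (cr 4 * Ci * s)%C Q) (mscale (cr 2 * Ci)%C Jm)) in
  let t4 := mscale kk
              (msub (msub (mscale (cr 2 * Ci)%C Q) (mscale (cr 2 * s)%C (mmul Qx Jm)))
                    (mscale (cr 2 * Ci * s)%C (mmul Jm Q2))) in
  let t5 := mscale (cr 2 * Ci * s)%C Q3 in
  let t6 := mscale Ci (mmul Jm Q2) in
  let t7 := mscale (Ci * s)%C Qxx in
  let t8 := mmul Qx Jm in
  let t9 := mscale s (msub (mmul Q Qx) (mmul Qx Q)) in
  madd (msub (msub (msub (msub (madd (madd (madd t1 t2) t3) t4) t5) t6) t7) t8) t9.

Definition hirota_solution (sigma q0 : R)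
  (q qx qxx qxxx qt : nat -> R -> R -> C) : Prop :=
  forall (j : nat) (x t : R), (j < 2)%nat ->
    is_derive (fun y => q j y t) x (qx j x t) /\
    is_derive (fun y => qx j y t) x (qxx j x t) /\
    is_derive (fun y => qxx j y t) x (qxxx j x t) /\
    is_derive (fun s => q j x s) t (qt j x t) /\
    (let v := fun h => q h x t in
     let vx := fun h => qx h x t in
     (Ci * qt j x t + qxx j x t
      - cr 2 * cr (nrm2 v - q0 ^ 2) * q j x t
      + Ci * cr sigma *
          (qxxx j x t - cr 3 * cr (nrm2 v) * qx j x t
           - cr 3 * herm v vx * q j x t))%C = cr 0).

(* boundary conditions lim_{x -> +oo} q = qp, lim_{x -> -oo} q = qm,
   and q(.,t) - q_pm in L^1(R^pm) (as an improper integral of the modulus,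
   q being continuous in x). *)
Definition boundary_conditions (q : nat -> R -> R -> C) (qp qm : vec) : Prop :=
  forall (j : nat) (t : R), (j < 2)%nat ->
    filterlim (fun x => q j x t) (Rbar_locally p_infty) (locally (qp j)) /\
    filterlim (fun x => q j x t) (Rbar_locally m_infty) (locally (qm j)) /\
    ex_RInt_gen (fun x => Cmod (q j x t - qp j)%C) (at_point 0) (Rbar_locally p_infty) /\
    ex_RInt_gen (fun x => Cmod (q j x t - qm j)%C) (Rbar_locally m_infty) (at_point 0).

Definition Yhat (q0 z : R) (qpm : vec) : mat := fun i j =>
  let r := rhohat q0 z in
  match i, j with
  | 0, 0 => (cr r * Ci)%C
  | 0, 1 => cr 0
  | 0, 2 => cr (r * (q0 / z))
  | S h, 0 => (cr r * Ci * qpm h / cr z)%C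
  | S h, 1 => (vperp qpm h / cr q0)%C
  | S h, 2 => (cr r * qpm h / cr q0)%C
  | _, _ => cr 0
  end%nat.

Definition cis (th : R) : C := (cos th, sin th).

Definition delta1 (sigma q0 z x t : R) : R :=
  let k := kz q0 z in let l := lz q0 z in
  l * x + 2 * l * (k + sigma * (3 * k ^ 2 - l ^ 2)) * t.
Definition delta2 (sigma q0 z x t : R) : R :=
  let k := kz q0 z in let l := lz q0 z in
  - k * x - (l ^ 2 + k ^ 2 + 4 * sigma * k ^ 3) * t.

Definition expiDelta (sigma q0 z x t : R) : mat := fun i j =>
  match i, j with
  | 0, 0 => cis (delta1 sigma q0 z x t)
  | 1, 1 => cis (delta2 sigma q0 z x t)
  | 2, 2 => cis (- delta1 sigma q0 z x t)
  | _, _ => cr 0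
  end%nat.

Definition lax_solution (sigma q0 : R) (q qx qxx : nat -> R -> R -> C)
  (psi : R -> R -> R -> mat) : Prop :=
  forall (z x t : R) (i j : nat), zdom q0 z -> (i < 3)%nat -> (j < 3)%nat ->
    let v := fun h => q h x t in
    let vx := fun h => qx h x t in
    let vxx := fun h => qxx h x t in
    is_derive (fun y => psi z y t i j) x
      (mmul (Xm (kz q0 z) v) (psi z x t) i j) /\
    is_derive (fun s => psi z x s i j) t
      (mmul (Tm sigma q0 (kz q0 z) v vx vxx) (psi z x t) i j).

Definition jost_asymptotics (sigma q0 : R) (qpm : vec) (F : (R -> Prop) -> Prop)
  (psi : R -> R -> R -> mat) : Prop :=
  forall (z t : R) (i j : nat), zdom q0 z -> (i < 3)%nat -> (j < 3)%nat ->
    filterlim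
      (fun x => (psi z x t i j
                 - mmul (Yhat q0 z qpm) (expiDelta sigma q0 z x t) i j)%C)
      F (locally (cr 0)).

Definition jost_pair (sigma q0 : R) (q qx qxx : nat -> R -> R -> C) (qp qm : vec)
  (psip psim : R -> R -> R -> mat) : Prop :=
  lax_solution sigma q0 q qx qxx psip /\
  lax_solution sigma q0 q qx qxx psim /\
  jost_asymptotics sigma q0 qp (Rbar_locally p_infty) psip /\
  jost_asymptotics sigma q0 qm (Rbar_locally m_infty) psim.

Definition scattering (q0 : R) (psip psim : R -> R -> R -> mat) (H S : R -> mat) : Prop :=
  forall z, zdom q0 z ->
    (forall (x t : R) (i j : nat), (i < 3)%nat -> (j < 3)%nat ->
        psip z x t i j = mmul (psim z x t) (H z) i j) /\
    (forall (i j : nat), (i < 3)%nat -> (j < 3)%nat ->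
        mmul (S z) (H z) i j = mid i j /\ mmul (H z) (S z) i j = mid i j).

Definition beta1 (S : R -> mat) (z : R) : C := (S z 0%nat 2%nat / S z 0%nat 0%nat)%C.
Definition beta2 (H : R -> mat) (z : R) : C := (H z 1%nat 0%nat / H z 0%nat 0%nat)%C.

(* reflectionless: beta_1 and beta_2 are defined (s11, h11 <> 0) and vanish
   on all of R \ {0, +-q0} *)
Definition reflectionless (q0 : R) (H S : R -> mat) : Prop :=
  forall z, zdom q0 z ->
    S z 0%nat 0%nat <> cr 0 /\ H z 0%nat 0%nat <> cr 0 /\
    beta1 S z = cr 0 /\ beta2 H z = cr 0.

(* Main.v *)
Require Import Defs.
From Stdlib Require Import Reals Lra Lia Psatz.
From Coquelicot Require Import Coquelicot.
Open Scope R_scope.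

(** Let [z] tend to [0+], so that [k = kz q0 z] tends to infinity, at [t = 0].
    The indefinite form [dotJ] of two Lax solutions does not depend on [x];
    hence [h21 = 0] makes the first column of [psi_+] and the second column of
    [psi_-] orthogonal for it. After rescaling, these columns are asymptotic to
    [(z, q_+)] and [(0, q_-^perp)] up to phases, and for large [k] the Lax
    equation merely rotates the last two components by [exp (- i k x)]: their
    coupling to the first component oscillates and averages out. So the
    orthogonality tends to [(q_-^perp)^dagger q_+ = 0], which says that [q_+]
    and [q_-] are parallel.

    To make this uniform in [k], the positive form [metric], conserved by the
    constant-coefficient equation, controls the difference with the asymptotic
    wave on the tails [|x| >= L] in terms of the [L^1] norm of [q - q_+-] there,
    with [L] chosen before [k]; on [[-L, L]] its derivative is [O(1/k)]. *)

(** * Derivatives of complex-valued functions of a real variable *)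

Lemma is_derive_C_components (f : R -> C) (x : R) (l : C) :
  is_derive f x l <->
  is_derive (fun y => fst (f y)) x (fst l) /\ is_derive (fun y => snd (f y)) x (snd l).
Proof.
split.
- intros Hf; split.
  + apply (filterdiff_comp' f (@fst R R) x _ (@fst R R) Hf).
    apply filterdiff_linear, is_linear_fst.
  + apply (filterdiff_comp' f (@snd R R) x _ (@snd R R) Hf).
    apply filterdiff_linear, is_linear_snd.
- intros [H1 H2].
  (* Conversely, [f] is rebuilt as its real part times [(1, 0)] plus its imaginary part times
     [(0, 1)]. *)
  pose proof (is_derive_scal_l (V := prod_NormedModule _ R_NormedModule R_NormedModule)
    _ _ _ ((1, 0) : C) H1) as K1.
  pose proof (is_derive_scal_l (V := prod_NormedModule _ R_NormedModule R_NormedModule)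
    _ _ _ ((0, 1) : C) H2) as K2.
  pose proof (is_derive_plus _ _ _ _ _ K1 K2) as K.
  replace l with (plus (scal (fst l) ((1,0) : prod_NormedModule _ R_NormedModule R_NormedModule))
                   (scal (snd l) ((0,1) : prod_NormedModule _ R_NormedModule R_NormedModule))).
  + eapply is_derive_ext; [|exact K].
    intros t; apply injective_projections; cbv; ring.
  + apply injective_projections; cbv; ring.
Qed.

Lemma is_derive_C_mult (f g : R -> C) (x : R) (df dg : C) :
  is_derive f x df -> is_derive g x dg ->
  is_derive (fun y => f y * g y)%C x (df * g x + f x * dg)%C.
Proof.
intros Hf Hg.
apply is_derive_C_components in Hf; apply is_derive_C_components in Hg.
destruct Hf as [F1 F2]; destruct Hg as [G1 G2].
apply is_derive_C_components; split; simpl.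
- evar_last.
  + apply @is_derive_minus; apply @is_derive_mult; eauto; intros; apply Rmult_comm.
  + unfold minus, plus, opp, mult; simpl; ring.
- evar_last.
  + apply @is_derive_plus; apply @is_derive_mult; eauto; intros; apply Rmult_comm.
  + unfold plus, mult; simpl; ring.
Qed.

Lemma is_derive_C_plus (f g : R -> C) (x : R) (df dg : C) :
  is_derive f x df -> is_derive g x dg ->
  is_derive (fun y => f y + g y)%C x (df + dg)%C.
Proof. intros Hf Hg; exact (is_derive_plus _ _ _ _ _ Hf Hg). Qed.

Lemma is_derive_C_minus (f g : R -> C) (x : R) (df dg : C) :
  is_derive f x df -> is_derive g x dg ->
  is_derive (fun y => f y - g y)%C x (df - dg)%C.
Proof. intros Hf Hg; exact (is_derive_minus _ _ _ _ _ Hf Hg). Qed.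

Lemma is_derive_C_conj (f : R -> C) (x : R) (df : C) :
  is_derive f x df -> is_derive (fun y => Cconj (f y)) x (Cconj df).
Proof.
intros Hf; apply is_derive_C_components in Hf; destruct Hf as [F1 F2].
apply is_derive_C_components; split; simpl; [exact F1|].
exact (is_derive_opp _ _ _ F2).
Qed.

Lemma is_derive_C_const (c : C) (x : R) : is_derive (fun _ : R => c) x (RtoC 0).
Proof. apply (is_derive_const (V := prod_NormedModule _ R_NormedModule R_NormedModule)). Qed.

Lemma is_derive_cis (a x : R) :
  is_derive (fun y => cis (a * y)) x (Ci * RtoC a * cis (a * x))%C.
Proof.
apply is_derive_C_components; split; unfold cis; simpl; auto_derive; auto; ring.
Qed.

Lemma is_derive_Re (f : R -> C) (x : R) (l : C) :
  is_derive f x l -> is_derive (fun y => Re (f y)) x (Re l).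
Proof. intros Hf; apply (proj1 (is_derive_C_components f x l) Hf). Qed.

Lemma Cmod_cis (a : R) : Cmod (cis a) = 1.
Proof.
unfold Cmod, cis; simpl.
replace (_ + _) with 1; [apply sqrt_1|].
generalize (sin2_cos2 a); unfold Rsqr; lra.
Qed.

(** * The two Hermitian forms and their evolution under the Lax equation *)

Definition mvmul (A : mat) (u : vec) : vec := fun i =>
  (A i 0%nat * u 0%nat + A i 1%nat * u 1%nat + A i 2%nat * u 2%nat)%C.

Definition dot (u w : vec) : C :=
  (Cconj (u 0%nat) * w 0%nat + Cconj (u 1%nat) * w 1%nat + Cconj (u 2%nat) * w 2%nat)%C.

Definition dotJ (u w : vec) : C :=
  (Cconj (u 0%nat) * w 0%nat - Cconj (u 1%nat) * w 1%nat - Cconj (u 2%nat) * w 2%nat)%C.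

Definition norm1 (u : vec) : R := Cmod (u 0%nat) + Cmod (u 1%nat) + Cmod (u 2%nat).

Definition norm1_2 (v : vec) : R := Cmod (v 0%nat) + Cmod (v 1%nat).

(* The matrix [I + J Q / k = J (k J + Q) / k]. As [J (k J + Q)] is Hermitian and
   [k J + Q] commutes with itself, the form it defines is conserved by the
   Lax equation with constant [Q]; it is positive once [k > |v|]. *)
Definition metric (k : R) (v u : vec) : vec := fun i =>
  match i with
  | 0%nat => u 0%nat - RtoC (/ k) * (Cconj (v 0%nat) * u 1%nat + Cconj (v 1%nat) * u 2%nat)
  | 1%nat => u 1%nat - RtoC (/ k) * (v 0%nat * u 0%nat)
  | 2%nat => u 2%nat - RtoC (/ k) * (v 1%nat * u 0%nat)
  | _ => RtoC 0
  end%C.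

Definition energy (k : R) (v u : vec) : R := Re (dot u (metric k v u)).

Ltac derive_C :=
  lazymatch goal with
  | |- is_derive (fun y => Cmult _ _) _ _ => apply is_derive_C_mult; derive_C
  | |- is_derive (fun y => Cplus _ _) _ _ => apply is_derive_C_plus; derive_C
  | |- is_derive (fun y => Cminus _ _) _ _ => apply is_derive_C_minus; derive_C
  | |- is_derive (fun y => Cconj _) _ _ => apply is_derive_C_conj; derive_C
  | H : is_derive ?f ?x _ |- is_derive ?f ?x _ => exact H
  | |- is_derive (fun y => ?c) _ _ => apply is_derive_C_const
  end.

Ltac generalize_components :=
  repeat match goal with
  | |- context [?f ?n] =>
      match type of (f n) with C =>
      match n with 0%nat => idtac | 1%nat => idtac | 2%nat => idtac end;
      let a := fresh "a" in let b := fresh "b" in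
      generalize (f n); intros [a b] end end.

(** Since [metric] is a multiple of [J (k J + Q)], the term [Xm k (v x)] contributes nothing. What
    is left is the forcing [r] and the variation of [v] inside [metric], which carries a factor
    [1 / k]. The tails use this with constant [v], the middle segment with [r = 0]. *)
Lemma energy_derive (k x : R) (v u : R -> vec) (dv r : vec) :
  k <> 0 ->
  (forall i, (i < 3)%nat ->
    is_derive (fun y => u y i) x (mvmul (Xm k (v x)) (u x) i + r i)%C) ->
  (forall j, (j < 2)%nat -> is_derive (fun y => v y j) x (dv j)) ->
  is_derive (fun y => energy k (v y) (u y)) x
    (2 * Re (dot (metric k (v x) (u x)) r)
     - 2 / k * Re (Cconj (u x 0%nat) *
         (Cconj (dv 0%nat) * u x 1%nat + Cconj (dv 1%nat) * u x 2%nat))).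
Proof.
intros Hk Hu Hv.
pose proof (Hu 0%nat ltac:(lia)) as U0; pose proof (Hu 1%nat ltac:(lia)) as U1.
pose proof (Hu 2%nat ltac:(lia)) as U2.
pose proof (Hv 0%nat ltac:(lia)) as V0; pose proof (Hv 1%nat ltac:(lia)) as V1.
evar_last.
- apply is_derive_Re. unfold dot, metric. derive_C.
- unfold mvmul, Xm, madd, mscale, Jm, Qm, dot, metric, cr, Ci. clear -Hk.
  generalize_components. cbn [fst snd Cplus Cmult Cminus Copp Cconj RtoC Re Im]. field. exact Hk.
Qed.

(** [J (k J + Q)] is Hermitian for every [Q], so [J X] is skew-Hermitian at each [x] even when the
    potential varies; only the defect [r] of [u] survives. *)
Lemma dotJ_derive (k x : R) (v : vec) (u w : R -> vec) (r : vec) :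
  (forall i, (i < 3)%nat ->
    is_derive (fun y => u y i) x (mvmul (Xm k v) (u x) i + r i)%C) ->
  (forall i, (i < 3)%nat ->
    is_derive (fun y => w y i) x (mvmul (Xm k v) (w x) i)) ->
  is_derive (fun y => dotJ (u y) (w y)) x (dotJ r (w x)).
Proof.
intros Hu Hw.
pose proof (Hu 0%nat ltac:(lia)) as U0; pose proof (Hu 1%nat ltac:(lia)) as U1.
pose proof (Hu 2%nat ltac:(lia)) as U2.
pose proof (Hw 0%nat ltac:(lia)) as W0; pose proof (Hw 1%nat ltac:(lia)) as W1.
pose proof (Hw 2%nat ltac:(lia)) as W2.
evar_last.
- unfold dotJ. derive_C.
- unfold mvmul, Xm, madd, mscale, Jm, Qm, dotJ, cr, Ci. clear.
  generalize_components. apply injective_projections; simpl; ring.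
Qed.

(** * Norm estimates and positivity of the energy *)

Lemma norm1_ge_0 (u : vec) : 0 <= norm1 u.
Proof.
unfold norm1; pose proof (Cmod_ge_0 (u 0%nat)); pose proof (Cmod_ge_0 (u 1%nat)).
pose proof (Cmod_ge_0 (u 2%nat)); lra.
Qed.

Lemma norm1_2_ge_0 (v : vec) : 0 <= norm1_2 v.
Proof. unfold norm1_2; apply Rplus_le_le_0_compat; apply Cmod_ge_0. Qed.

Lemma Cmod_minus_le (a b : C) : Cmod (a - b) <= Cmod a + Cmod b.
Proof. unfold Cminus; rewrite <- (Cmod_opp b); apply Cmod_triangle. Qed.

Lemma Cmod_bilinear_le (a b a' b' : C) :
  Cmod (Cconj a * a' + Cconj b * b') <= (Cmod a + Cmod b) * (Cmod a' + Cmod b').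
Proof.
eapply Rle_trans; [apply Cmod_triangle|]; rewrite !Cmod_mult, !Cmod_conj.
pose proof (Cmod_ge_0 a); pose proof (Cmod_ge_0 b); pose proof (Cmod_ge_0 a').
pose proof (Cmod_ge_0 b'); nra.
Qed.

Lemma norm1_products_le (a b c a' b' c' : R) :
  0 <= a -> 0 <= b -> 0 <= c -> 0 <= a' -> 0 <= b' -> 0 <= c' ->
  a * a' + b * b' + c * c' <= (a + b + c) * (a' + b' + c').
Proof. intros; nra. Qed.

Lemma Cmod_dot_le (u w : vec) : Cmod (dot u w) <= norm1 u * norm1 w.
Proof.
unfold dot, norm1.
eapply Rle_trans; [apply Cmod_triangle|].
eapply Rle_trans; [apply Rplus_le_compat_r, Cmod_triangle|].
rewrite !Cmod_mult, !Cmod_conj.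
apply norm1_products_le; apply Cmod_ge_0.
Qed.

Lemma Cmod_dotJ_le (u w : vec) : Cmod (dotJ u w) <= norm1 u * norm1 w.
Proof.
unfold dotJ, norm1.
eapply Rle_trans; [apply Cmod_minus_le|].
eapply Rle_trans; [apply Rplus_le_compat_r, Cmod_minus_le|].
rewrite !Cmod_mult, !Cmod_conj.
apply norm1_products_le; apply Cmod_ge_0.
Qed.

Lemma norm1_metric_le (k : R) (v u : vec) :
  0 < k -> norm1_2 v <= k / 4 -> norm1 (metric k v u) <= 2 * norm1 u.
Proof.
unfold norm1, norm1_2, metric; intros Hk Hv.
assert (Hk' : 0 < / k) by now apply Rinv_0_lt_compat.
pose proof (Cmod_minus_le (u 0%nat)
  (RtoC (/ k) * (Cconj (v 0%nat) * u 1%nat + Cconj (v 1%nat) * u 2%nat))) as H0.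
pose proof (Cmod_minus_le (u 1%nat) (RtoC (/ k) * (v 0%nat * u 0%nat))) as H1.
pose proof (Cmod_minus_le (u 2%nat) (RtoC (/ k) * (v 1%nat * u 0%nat))) as H2.
pose proof (Cmod_bilinear_le (v 0%nat) (v 1%nat) (u 1%nat) (u 2%nat)) as H3.
rewrite !Cmod_mult, !Cmod_R, !Rabs_pos_eq in H0, H1, H2 by lra.
rewrite (Cmod_mult (v 0%nat)) in H1; rewrite (Cmod_mult (v 1%nat)) in H2.
pose proof (Cmod_ge_0 (u 0%nat)); pose proof (Cmod_ge_0 (u 1%nat)).
pose proof (Cmod_ge_0 (u 2%nat)); pose proof (Cmod_ge_0 (v 0%nat)).
pose proof (Cmod_ge_0 (v 1%nat)).
assert (Hm : / k * (Cmod (v 0%nat) + Cmod (v 1%nat)) <= / 4).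
{ apply (Rmult_le_reg_l k); [lra|]. field_simplify; lra. }
assert (/ k * Cmod (Cconj (v 0%nat) * u 1%nat + Cconj (v 1%nat) * u 2%nat)
  <= / k * (Cmod (v 0%nat) + Cmod (v 1%nat)) * (Cmod (u 1%nat) + Cmod (u 2%nat)))%R.
{ rewrite Rmult_assoc; apply Rmult_le_compat_l; lra. }
assert (/ k * (Cmod (v 0%nat) * Cmod (u 0%nat)) + / k * (Cmod (v 1%nat) * Cmod (u 0%nat))
  <= / 4 * Cmod (u 0%nat)).
{ replace (_ + _) with (/ k * (Cmod (v 0%nat) + Cmod (v 1%nat)) * Cmod (u 0%nat)) by ring.
  now apply Rmult_le_compat_r. }
assert (/ k * (Cmod (v 0%nat) + Cmod (v 1%nat)) * (Cmod (u 1%nat) + Cmod (u 2%nat))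
  <= / 4 * (Cmod (u 1%nat) + Cmod (u 2%nat))) by (apply Rmult_le_compat_r; lra).
lra.
Qed.

Lemma energy_alt (k : R) (v u : vec) :
  energy k v u = Cmod (u 0%nat) ^ 2 + Cmod (u 1%nat) ^ 2 + Cmod (u 2%nat) ^ 2
    - 2 * / k * Re (Cconj (u 0%nat) * (Cconj (v 0%nat) * u 1%nat + Cconj (v 1%nat) * u 2%nat)).
Proof.
rewrite !Cmod2_alt; unfold energy, dot, metric; generalize_components.
cbn [fst snd Cplus Cmult Cminus Copp Cconj RtoC Re Im]; ring.
Qed.

(** When the potential is at most [k / 4], the cross term takes away at most half of the sum of
    squares. The constant 6 is this factor 2 times the 3 that compares [norm1 u ^ 2] with the sum of
    squares. *)
Lemma energy_bounds (k : R) (v u : vec) :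
  0 < k -> norm1_2 v <= k / 4 ->
  norm1 u ^ 2 <= 6 * energy k v u /\ energy k v u <= 2 * norm1 u ^ 2.
Proof.
unfold norm1_2; intros Hk Hv; rewrite energy_alt; unfold norm1.
assert (Hk' : 0 < / k) by now apply Rinv_0_lt_compat.
pose proof (re_le_Cmod (Cconj (u 0%nat) *
  (Cconj (v 0%nat) * u 1%nat + Cconj (v 1%nat) * u 2%nat))) as H0.
rewrite Cmod_mult, Cmod_conj in H0.
pose proof (Cmod_bilinear_le (v 0%nat) (v 1%nat) (u 1%nat) (u 2%nat)) as H3.
apply Rabs_le_between in H0.
set (S := Re _) in *; clearbody S.
set (M := Cmod (_ + _)) in *; clearbody M.
pose proof (Cmod_ge_0 (u 0%nat)); pose proof (Cmod_ge_0 (u 1%nat)).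
pose proof (Cmod_ge_0 (u 2%nat)); pose proof (Cmod_ge_0 (v 0%nat)).
pose proof (Cmod_ge_0 (v 1%nat)).
set (a := Cmod (u 0%nat)) in *; set (b := Cmod (u 1%nat)) in *.
set (c := Cmod (u 2%nat)) in *; clearbody a b c.
set (m := Cmod (v 0%nat) + Cmod (v 1%nat)) in *.
assert (Hm : / k * m <= / 4).
{ apply (Rmult_le_reg_l k); [lra|]. field_simplify; lra. }
assert (HS : / k * Rabs S <= / 4 * (a * (b + c))).
{ apply Rle_trans with (/ k * (a * (m * (b + c)))).
  - apply Rmult_le_compat_l; [lra|]. apply Rle_trans with (a * M); [apply Rabs_le; lra | nra].
  - replace (/ k * (a * (m * (b + c)))) with ((/ k * m) * (a * (b + c))) by ring.
    apply Rmult_le_compat_r; nra. }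
assert (- (/4 * (a * (b + c))) <= / k * S <= /4 * (a * (b + c))).
{ apply Rabs_le_between; rewrite Rabs_mult, (Rabs_pos_eq (/ k)); lra. }
assert (a * b <= (a ^ 2 + b ^ 2) / 2) by (pose proof (pow2_ge_0 (a - b)); nra).
assert (a * c <= (a ^ 2 + c ^ 2) / 2) by (pose proof (pow2_ge_0 (a - c)); nra).
assert (b * c <= (b ^ 2 + c ^ 2) / 2) by (pose proof (pow2_ge_0 (b - c)); nra).
assert (0 <= a * b) by nra. assert (0 <= a * c) by nra. assert (0 <= b * c) by nra.
split; nra.
Qed.

(** * Gronwall inequalities anchored at infinity *)

Lemma nonneg_derive_increasing (f df : R -> R) (a b : R) :
  (forall x, a <= x <= b -> is_derive f x (df x)) ->
  (forall x, a <= x <= b -> 0 <= df x) -> a <= b -> f a <= f b.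
Proof.
intros Hf Hdf Hab.
destruct (MVT_gen f a b df) as [c [Hc E]];
  rewrite Rmin_left, Rmax_right in * by lra.
- intros x Hx; apply Hf; lra.
- intros x Hx; apply continuity_pt_filterlim.
  apply (ex_derive_continuous (K := R_AbsRing) (V := R_NormedModule)). eexists; apply Hf; lra.
- pose proof (Hdf c Hc); nra.
Qed.

(** The hypothesis on [dN] makes [(N + W) * exp (K * E)] nondecreasing, so it stays below its limit
    [W * exp (K * l)] at infinity. *)
Lemma gronwall_p_infty (N E dN m : R -> R) (K W l : R) :
  (forall x, is_derive N x (dN x)) -> (forall x, is_derive E x (m x)) ->
  (forall x, - (K * m x * (N x + W)) <= dN x) ->
  filterlim N (Rbar_locally p_infty) (locally 0) ->
  filterlim E (Rbar_locally p_infty) (locally l) ->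
  forall x, N x + W <= W * exp (K * (l - E x)).
Proof.
intros HN HE Hd LN LE x.
assert (HG : forall y, x <= y ->
  (N x + W) * exp (K * E x) <= (N y + W) * exp (K * E y)).
{ intros y Hy.
  apply (nonneg_derive_increasing (fun y => (N y + W) * exp (K * E y))
    (fun y => (dN y + K * m y * (N y + W)) * exp (K * E y))); [| |exact Hy].
  - intros z _; pose proof (HN z) as H1; pose proof (HE z) as H2.
    auto_derive.
    + repeat split; [exists (dN z) | exists (m z)]; assumption.
    + replace (Derive (fun x : R => N x) z) with (dN z) by (symmetry; now apply is_derive_unique).
      replace (Derive (fun x : R => E x) z) with (m z) by (symmetry; now apply is_derive_unique).
      ring.
  - intros z _; specialize (Hd z); pose proof (exp_pos (K * E z)).
    apply Rmult_le_pos; lra. }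
assert (HL : filterlim (fun y => (N y + W) * exp (K * E y)) (Rbar_locally p_infty)
  (locally ((0 + W) * exp (K * l)))).
{ apply (is_lim_mult (fun y => N y + W) (fun y => exp (K * E y)) p_infty (0 + W) (exp (K * l)));
    [| |exact I].
  - apply (is_lim_plus' N (fun _ => W) p_infty 0 W); [exact LN | apply is_lim_const].
  - apply (is_lim_comp_continuous (fun y => K * E y) exp p_infty (K * l)).
    + apply (is_lim_scal_l E K p_infty l); exact LE.
    + apply continuous_exp. }
assert (H' : (N x + W) * exp (K * E x) <= (0 + W) * exp (K * l)).
{ apply (filterlim_le (F := Rbar_locally p_infty) (fun _ => (N x + W) * exp (K * E x))
    (fun y => (N y + W) * exp (K * E y)) ((N x + W) * exp (K * E x)) ((0 + W) * exp (K * l)));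
    [|apply filterlim_const | exact HL].
  exists x; intros y Hy; apply HG; lra. }
apply (Rmult_le_reg_r (exp (K * E x))); [apply exp_pos|].
rewrite Rmult_assoc, <- exp_plus.
replace (K * (l - E x) + K * E x) with (K * l) by ring; lra.
Qed.

(** Reflection of the previous inequality: [N (- y)] and [- E (- y)] take the places of [N] and
    [E]. *)
Lemma gronwall_m_infty (N E dN m : R -> R) (K W l : R) :
  (forall x, is_derive N x (dN x)) -> (forall x, is_derive E x (m x)) ->
  (forall x, dN x <= K * m x * (N x + W)) ->
  filterlim N (Rbar_locally m_infty) (locally 0) ->
  filterlim E (Rbar_locally m_infty) (locally l) ->
  forall x, N x + W <= W * exp (K * (E x - l)).
Proof.
intros HN HE Hd LN LE x.
assert (Lopp : filterlim Ropp (Rbar_locally p_infty) (Rbar_locally m_infty))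
  by apply (filterlim_Rbar_opp p_infty).
pose proof (gronwall_p_infty (fun y => N (- y)) (fun y => - E (- y))
  (fun y => - dN (- y)) (fun y => m (- y)) K W (- l)) as H.
replace (K * (E x - l)) with (K * (- l - - E (- - x))) by (rewrite Ropp_involutive; ring).
rewrite <- (Ropp_involutive x) at 1.
apply (H); clear H.
- intros y; auto_derive; [exists (dN (- y)); apply HN|].
  replace (Derive (fun x : R => N x) (- y)) with (dN (- y))
    by (symmetry; apply is_derive_unique, HN).
  ring.
- intros y; auto_derive; [exists (m (- y)); apply HE|].
  replace (Derive (fun x : R => E x) (- y)) with (m (- y))
    by (symmetry; apply is_derive_unique, HE).
  ring.
- intros y; specialize (Hd (- y)); lra.
- apply (filterlim_comp _ _ _ _ _ _ _ _ Lopp LN).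
- apply (filterlim_comp _ _ _ (fun y => E (- y)) Ropp _ (locally l)).
  + apply (filterlim_comp _ _ _ _ _ _ _ _ Lopp LE).
  + apply (filterlim_opp (V := R_NormedModule) l).
Qed.

(** * Limits in modulus and primitives of integrable weights *)

Lemma filterlim_Cmod_lt (F : (R -> Prop) -> Prop) {FF : Filter F} (f : R -> C) (d : R) :
  filterlim f F (locally (RtoC 0)) -> 0 < d -> F (fun x => Cmod (f x) < d).
Proof.
intros Hf Hd.
(* Balls of the product structure are squares, so each coordinate is kept below [d / 2] and the
   modulus is bounded by the sum of the two. *)
pose proof (proj1 (filterlim_locally (U := C_UniformSpace) f (RtoC 0)) Hf (mkposreal (d / 2) ltac:(lra))) as H.
revert H; apply filter_imp; intros x [H1 H2].
unfold ball in H1, H2; simpl in H1, H2; unfold AbsRing_ball, abs, minus, plus, opp in H1, H2.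
simpl in H1, H2; rewrite Ropp_0, Rplus_0_r in H1, H2.
apply Rle_lt_trans with (Rabs (fst (f x)) + Rabs (snd (f x))); [|lra].
replace (f x) with (RtoC (fst (f x)) + Ci * RtoC (snd (f x)))%C at 1
  by (apply injective_projections; simpl; ring).
eapply Rle_trans; [apply Cmod_triangle|].
rewrite Cmod_mult, !Cmod_R, Cmod_Ci; lra.
Qed.

Lemma primitive_of_integrable (m : R -> R) :
  (forall x, continuous m x) ->
  exists E, (forall x, is_derive E x (m x)) /\
   (ex_RInt_gen m (at_point 0) (Rbar_locally p_infty) ->
     exists l, filterlim E (Rbar_locally p_infty) (locally l)) /\
   (ex_RInt_gen m (Rbar_locally m_infty) (at_point 0) ->
     exists l, filterlim E (Rbar_locally m_infty) (locally l)).
Proof.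
intros Hm.
assert (Hex : forall a b, ex_RInt m a b)
  by (intros; apply (ex_RInt_continuous (V := R_CompleteNormedModule)); auto).
exists (fun x => RInt m 0 x); split; [|split].
- intros x; apply (is_derive_RInt m _ 0); [|apply Hm].
  apply filter_forall; intros y; apply (RInt_correct m), Hex.
- intros [l Hl]; exists l; intros P HP.
  destruct (Hl P HP) as [Q R HQ HR H].
  unfold filtermap; revert HR; apply filter_imp; intros x Hx.
  destruct (H 0 x HQ Hx) as [y [Hy1 Hy2]].
  simpl in Hy1; now rewrite (is_RInt_unique _ _ _ _ Hy1).
(* The improper integral runs from minus infinity to 0, whereas the primitive starts at 0; hence the
   sign. *)
- intros [l Hl]; exists (opp l); intros P HP.
  destruct (Hl (fun y => P (opp y)) (filterlim_opp (V := R_NormedModule) l P HP)) as [Q R HQ HR H].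
  unfold filtermap; revert HQ; apply filter_imp; intros x Hx.
  destruct (H x 0 Hx HR) as [y [Hy1 Hy2]].
  replace (RInt m 0 x) with (opp y); [exact Hy2|].
  simpl in Hy1; rewrite <- (is_RInt_unique _ _ _ _ Hy1).
  apply (opp_RInt_swap m), Hex.
Qed.

(** * Comparison with a constant background on the tails *)

Definition vsub (u w : vec) : vec := fun i => (u i - w i)%C.

Lemma norm1_potential_le (d u : vec) :
  norm1 (mvmul (mscale Ci (Qm d)) u) <= norm1_2 d * norm1 u.
Proof.
unfold norm1, norm1_2, mvmul, mscale, Qm, cr.
replace (Ci * RtoC 0 * u 0%nat + Ci * - Cconj (d 0%nat) * u 1%nat
  + Ci * - Cconj (d 1%nat) * u 2%nat)%C
  with (- Ci * (Cconj (d 0%nat) * u 1%nat + Cconj (d 1%nat) * u 2%nat))%C by ring.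
replace (Ci * d 0%nat * u 0%nat + Ci * RtoC 0 * u 1%nat + Ci * RtoC 0 * u 2%nat)%C
  with (Ci * (d 0%nat * u 0%nat))%C by ring.
replace (Ci * d 1%nat * u 0%nat + Ci * RtoC 0 * u 1%nat + Ci * RtoC 0 * u 2%nat)%C
  with (Ci * (d 1%nat * u 0%nat))%C by ring.
rewrite !(Cmod_mult Ci), !(Cmod_mult (- Ci)), Cmod_opp, Cmod_Ci, !(Cmod_mult (d _)).
pose proof (Cmod_bilinear_le (d 0%nat) (d 1%nat) (u 1%nat) (u 2%nat)); lra.
Qed.

Section Background.

Variables (k : R) (c : vec) (q psi w : R -> vec) (E : R -> R) (W : R).
Hypothesis Hk : 0 < k.
Hypothesis Hc : norm1_2 c <= k / 4.
Hypothesis Hpsi : forall x i, (i < 3)%nat ->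
  is_derive (fun y => psi y i) x (mvmul (Xm k (q x)) (psi x) i).
Hypothesis Hw : forall x i, (i < 3)%nat ->
  is_derive (fun y => w y i) x (mvmul (Xm k c) (w x) i).
Hypothesis HW : forall x, norm1 (w x) <= W.
Hypothesis HE : forall x, is_derive E x (norm1_2 (vsub (q x) c)).

Let u (x : R) : vec := vsub (psi x) (w x).
Let r (x : R) : vec := mvmul (mscale Ci (Qm (vsub (q x) c))) (psi x).

(** As [Xm] is affine in the potential, the error [u] solves the equation with constant potential
    [c] and forcing [r]; the constant-coefficient part conserves the energy. *)
Lemma error_energy_derive (x : R) :
  is_derive (fun y => energy k c (u y)) x (2 * Re (dot (metric k c (u x)) (r x))).
Proof.
evar_last.
- apply (energy_derive k x (fun _ => c) u (fun _ => RtoC 0) (r x)); [lra | |].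
  + intros i Hi.
    pose proof (is_derive_C_minus _ _ _ _ _ (Hpsi x i Hi) (Hw x i Hi)) as H.
    unfold u at 1, vsub at 1. evar_last; [exact H|].
    unfold u, r, mvmul, Xm, madd, mscale, vsub.
    destruct i as [|[|[|i]]]; [| | | lia]; simpl;
      rewrite ?Cminus_conj; unfold cr; ring.
  + intros j Hj; apply is_derive_C_const.
- simpl; unfold Rdiv; ring.
Qed.

(** The forcing contains [psi], not the error alone, so its size is at most the weight times
    [norm1 (u x) + W]. This is what puts [W ^ 2] next to the energy. *)
Lemma error_energy_bound (x : R) :
  Rabs (2 * Re (dot (metric k c (u x)) (r x)))
  <= 36 * norm1_2 (vsub (q x) c) * (energy k c (u x) + W ^ 2).
Proof.
rewrite Rabs_mult, (Rabs_pos_eq 2) by lra.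
pose proof (re_le_Cmod (dot (metric k c (u x)) (r x))) as H1.
pose proof (Cmod_dot_le (metric k c (u x)) (r x)) as H2.
pose proof (norm1_metric_le k c (u x) Hk Hc) as H3.
pose proof (norm1_potential_le (vsub (q x) c) (psi x)) as H4; fold (r x) in H4.
destruct (energy_bounds k c (u x) Hk Hc) as [H5 _].
assert (H6 : norm1 (psi x) <= norm1 (u x) + W).
{ pose proof (HW x) as HWx; revert HWx; unfold norm1, u, vsub.
  assert (T : forall a b, Cmod a <= Cmod (a - b) + Cmod b).
  { intros a b; replace a with (a - b + b)%C at 1 by ring; apply Cmod_triangle. }
  pose proof (T (psi x 0%nat) (w x 0%nat)); pose proof (T (psi x 1%nat) (w x 1%nat)).
  pose proof (T (psi x 2%nat) (w x 2%nat)); lra. }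
assert (Hd : 0 <= norm1_2 (vsub (q x) c)) by apply norm1_2_ge_0.
pose proof (norm1_ge_0 (u x)); pose proof (norm1_ge_0 (r x)).
pose proof (norm1_ge_0 (metric k c (u x))).
set (m := norm1_2 (vsub (q x) c)) in *; set (U := norm1 (u x)) in *; clearbody m U.
assert (K1 : norm1 (metric k c (u x)) * norm1 (r x) <= 2 * U * (m * (U + W))).
{ apply Rmult_le_compat; try lra. apply Rle_trans with (1 := H4).
  apply Rmult_le_compat_l; lra. }
(* [2 U (U + W)] is at most [3 U ^ 2 + W ^ 2], and [U ^ 2] is at most 6 times the energy. *)
assert (K2 : 2 * U * (U + W) <= 18 * (energy k c (u x) + W ^ 2)).
{ pose proof (pow2_ge_0 (U - W)); pose proof (pow2_ge_0 W); nra. }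
assert (K3 : m * (2 * U * (U + W)) <= m * (18 * (energy k c (u x) + W ^ 2)))
  by now apply Rmult_le_compat_l.
lra.
Qed.

Lemma error_energy_lim (F : (R -> Prop) -> Prop) {FF : Filter F} :
  (forall i, (i < 3)%nat -> filterlim (fun x => u x i) F (locally (RtoC 0))) ->
  filterlim (fun x => energy k c (u x)) F (locally 0).
Proof.
intros Hu; apply (filterlim_locally (U := R_UniformSpace)); intros [e He].
set (d := Rmin 1 (e / 18) / 3).
assert (Hd : 0 < d) by (unfold d; apply Rdiv_lt_0_compat; [apply Rmin_pos|]; lra).
pose proof (filterlim_Cmod_lt F _ d (Hu 0%nat ltac:(lia)) Hd) as H0.
pose proof (filterlim_Cmod_lt F _ d (Hu 1%nat ltac:(lia)) Hd) as H1.
pose proof (filterlim_Cmod_lt F _ d (Hu 2%nat ltac:(lia)) Hd) as H2.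
generalize (filter_and _ _ H0 (filter_and _ _ H1 H2)).
apply filter_imp; intros x [K0 [K1 K2]].
destruct (energy_bounds k c (u x) Hk Hc) as [B1 B2].
pose proof (norm1_ge_0 (u x)).
assert (norm1 (u x) < 3 * d) by (unfold norm1; lra).
assert (3 * d <= 1 /\ 3 * d <= e / 18).
{ unfold d; replace (3 * (_ / 3)) with (Rmin 1 (e / 18)) by field.
  split; [apply Rmin_l | apply Rmin_r]. }
change (Rabs (energy k c (u x) - 0) < e).
apply Rabs_def1; nra.
Qed.

(** Gronwall applied to the error energy, which vanishes at infinity. The bound does not involve
    [k]: only [W] and the remaining mass [l - E x] of the weight enter. *)
Lemma tail_p_infty (l : R) :
  (forall i, (i < 3)%nat ->
    filterlim (fun x => psi x i - w x i)%C (Rbar_locally p_infty) (locally (RtoC 0))) ->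
  filterlim E (Rbar_locally p_infty) (locally l) ->
  forall x, norm1 (vsub (psi x) (w x)) ^ 2 <= 6 * (W ^ 2 * (exp (36 * (l - E x)) - 1)).
Proof.
intros Hlim HEl x.
destruct (energy_bounds k c (u x) Hk Hc) as [B1 _].
pose proof (gronwall_p_infty (fun y => energy k c (u y)) E _ _ 36 (W ^ 2) l
  error_energy_derive HE) as H.
cut (energy k c (u x) + W ^ 2 <= W ^ 2 * exp (36 * (l - E x))).
{ fold (u x); lra. }
apply H; [|apply error_energy_lim; [apply _ | exact Hlim] | exact HEl].
intros y; pose proof (error_energy_bound y) as HB; apply Rabs_le_between in HB; lra.
Qed.

Lemma tail_m_infty (l : R) :
  (forall i, (i < 3)%nat ->
    filterlim (fun x => psi x i - w x i)%C (Rbar_locally m_infty) (locally (RtoC 0))) ->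
  filterlim E (Rbar_locally m_infty) (locally l) ->
  forall x, norm1 (vsub (psi x) (w x)) ^ 2 <= 6 * (W ^ 2 * (exp (36 * (E x - l)) - 1)).
Proof.
intros Hlim HEl x.
destruct (energy_bounds k c (u x) Hk Hc) as [B1 _].
pose proof (gronwall_m_infty (fun y => energy k c (u y)) E _ _ 36 (W ^ 2) l
  error_energy_derive HE) as H.
cut (energy k c (u x) + W ^ 2 <= W ^ 2 * exp (36 * (E x - l))).
{ fold (u x); lra. }
apply H; [|apply error_energy_lim; [apply _ | exact Hlim] | exact HEl].
intros y; pose proof (error_energy_bound y) as HB; apply Rabs_le_between in HB; lra.
Qed.

End Background.

(** * Estimates for large [k] on a bounded segment *)

Lemma Cmod_le_Rabs (c : C) : Cmod c <= Rabs (Re c) + Rabs (Im c).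
Proof.
replace c with (RtoC (Re c) + Ci * RtoC (Im c))%C at 1
  by (apply injective_projections; unfold Re, Im; simpl; ring).
eapply Rle_trans; [apply Cmod_triangle|].
rewrite Cmod_mult, !Cmod_R, Cmod_Ci; lra.
Qed.

Lemma Rabs_Im_le_Cmod (c : C) : Rabs (Im c) <= Cmod c.
Proof. eapply Rle_trans; [apply Rmax_r | apply Rmax_Cmod]. Qed.

Lemma mean_value_ineq (f df : R -> R) (a b K : R) :
  a <= b -> (forall x, a <= x <= b -> is_derive f x (df x)) ->
  (forall x, a <= x <= b -> Rabs (df x) <= K) -> Rabs (f b - f a) <= K * (b - a).
Proof.
intros Hab Hf Hdf.
destruct (MVT_gen f a b df) as [c [Hc ->]];
  rewrite Rmin_left, Rmax_right in * by lra.
- intros x Hx; apply Hf; lra.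
- intros x Hx; apply continuity_pt_filterlim.
  apply (ex_derive_continuous (K := R_AbsRing) (V := R_NormedModule)). eexists; apply Hf; lra.
- rewrite Rabs_mult, (Rabs_pos_eq (b - a)) by lra.
  apply Rmult_le_compat_r; [lra | auto].
Qed.

(** The factor 2 comes from treating real and imaginary parts separately. *)
Lemma mean_value_ineq_C (f df : R -> C) (a b K : R) :
  a <= b -> (forall x, a <= x <= b -> is_derive f x (df x)) ->
  (forall x, a <= x <= b -> Cmod (df x) <= K) -> Cmod (f b - f a) <= 2 * K * (b - a).
Proof.
intros Hab Hf Hdf.
assert (H1 : Rabs (fst (f b) - fst (f a)) <= K * (b - a)).
{ apply (mean_value_ineq (fun x => fst (f x)) (fun x => fst (df x))); [exact Hab | |];
    intros x Hx.
  - apply (is_derive_C_components f x (df x)), Hf, Hx.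
  - eapply Rle_trans; [apply re_le_Cmod | apply Hdf, Hx]. }
assert (H2 : Rabs (snd (f b) - snd (f a)) <= K * (b - a)).
{ apply (mean_value_ineq (fun x => snd (f x)) (fun x => snd (df x))); [exact Hab | |];
    intros x Hx.
  - apply (is_derive_C_components f x (df x)), Hf, Hx.
  - eapply Rle_trans; [apply Rabs_Im_le_Cmod | apply Hdf, Hx]. }
pose proof (Cmod_le_Rabs (f b - f a)) as H; simpl in H; unfold Rminus in *; lra.
Qed.

Section Middle.

Variables (k a b M : R) (q qx psi : R -> vec).
Hypothesis Hk : 0 < k.
Hypothesis Hab : a <= b.
Hypothesis HM : forall x, a <= x <= b -> norm1_2 (q x) <= M /\ norm1_2 (qx x) <= M.
Hypothesis HMk : 4 * M <= k.
Hypothesis Hq : forall x j, (j < 2)%nat -> is_derive (fun y => q y j) x (qx x j).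
Hypothesis Hpsi : forall x i, (i < 3)%nat ->
  is_derive (fun y => psi y i) x (mvmul (Xm k (q x)) (psi x) i).

Lemma segment_bound_ge_0 : 0 <= M.
Proof.
destruct (HM a ltac:(lra)) as [H _]; pose proof (norm1_2_ge_0 (q a)); lra.
Qed.

(** With the potential [q] itself inside [metric] there is no forcing, and the energy changes only
    at relative rate [eta], of order [1 / k]. The bound is propagated leftwards from [b], the side
    on which the first column of [psi_+] is controlled. *)
Lemma solution_bound :
  12 * M / k * (b - a) <= 1 ->
  forall x, a <= x <= b -> norm1 (psi x) <= 6 * norm1 (psi b).
Proof.
intros Hsmall x Hx; pose proof segment_bound_ge_0 as HM0.
set (N := fun y => energy k (q y) (psi y)).
set (eta := 12 * M / k) in *.
set (dN := fun y => - (2 / k * Re (Cconj (psi y 0%nat) *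
         (Cconj (qx y 0%nat) * psi y 1%nat + Cconj (qx y 1%nat) * psi y 2%nat)))).
assert (HN : forall y, is_derive N y (dN y)).
{ intros y; evar_last.
  - apply (energy_derive k y q psi (qx y) (fun _ => RtoC 0)); [lra | | intros; now apply Hq].
    intros i Hi; rewrite Cplus_0_r; now apply Hpsi.
  - unfold dN, dot; simpl; ring. }
assert (HB : forall y, a <= y <= b ->
  norm1 (psi y) ^ 2 <= 6 * N y /\ N y <= 2 * norm1 (psi y) ^ 2).
{ intros y Hy; apply energy_bounds; [lra|]. destruct (HM y Hy); lra. }
assert (Hki : 0 < / k) by now apply Rinv_0_lt_compat.
assert (Heta : 0 <= eta) by (unfold eta, Rdiv; apply Rmult_le_pos; lra).
assert (HdN : forall y, a <= y <= b -> - (eta * N y) <= dN y).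
{ intros y Hy; destruct (HB y Hy) as [B1 _]; destruct (HM y Hy) as [_ B2].
  pose proof (re_le_Cmod (Cconj (psi y 0%nat) *
    (Cconj (qx y 0%nat) * psi y 1%nat + Cconj (qx y 1%nat) * psi y 2%nat))) as H1.
  rewrite Cmod_mult, Cmod_conj in H1; apply Rabs_le_between in H1.
  pose proof (Cmod_bilinear_le (qx y 0%nat) (qx y 1%nat) (psi y 1%nat) (psi y 2%nat)) as H2.
  unfold dN; set (S := Re _) in *; set (T := Cmod (Cconj _ * _ + _)) in *.
  unfold norm1_2 in B2; unfold norm1 in B1.
  pose proof (Cmod_ge_0 (psi y 0%nat)); pose proof (Cmod_ge_0 (psi y 1%nat)).
  pose proof (Cmod_ge_0 (psi y 2%nat)).
  clearbody S T; set (p := Cmod (psi y 0%nat)) in *; set (s := Cmod (psi y 1%nat)) in *.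
  set (t := Cmod (psi y 2%nat)) in *; clearbody p s t.
  assert (HT : T <= M * (s + t)) by nra.
  assert (HS : S <= 6 * M * N y).
  { apply Rle_trans with (p * (M * (s + t))); [nra|].
    apply Rle_trans with (M * (p + s + t) ^ 2); [|nra].
    replace (p * (M * (s + t))) with (M * (p * (s + t))) by ring.
    apply Rmult_le_compat_l; nra. }
  unfold eta, Rdiv.
  replace (12 * M * / k * N y) with (2 * / k * (6 * M * N y)) by ring.
  apply Ropp_le_contravar, Rmult_le_compat_l; lra. }
assert (HG : N x * exp (eta * x) <= N b * exp (eta * b)).
{ apply (nonneg_derive_increasing (fun y => N y * exp (eta * y))
    (fun y => (dN y + eta * N y) * exp (eta * y))); [| | lra].
  - intros y _; auto_derive; [exists (dN y); apply HN|].
    replace (Derive (fun x : R => N x) y) with (dN y)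
      by (symmetry; apply is_derive_unique, HN).
    ring.
  - intros y Hy; pose proof (exp_pos (eta * y)); pose proof (HdN y ltac:(lra)).
    apply Rmult_le_pos; lra. }
assert (HN3 : N x <= 3 * N b).
{ apply (Rmult_le_reg_r (exp (eta * x))); [apply exp_pos|].
  apply Rle_trans with (1 := HG).
  replace (eta * b) with (eta * (b - x) + eta * x) by ring.
  rewrite exp_plus, <- Rmult_assoc; apply Rmult_le_compat_r; [left; apply exp_pos|].
  (* The smallness hypothesis says that [eta * (b - a)] is at most 1, so the growth factor is at
     most [exp 1]. *)
  assert (exp (eta * (b - x)) <= 3).
  { apply Rle_trans with (exp 1); [|apply exp_le_3].
    assert (eta * (b - x) <= 1) by nra.
    destruct (Req_dec (eta * (b - x)) 1) as [->|]; [lra | left; apply exp_increasing; lra]. }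
  destruct (HB b ltac:(lra)) as [B1 _]; pose proof (pow2_ge_0 (norm1 (psi b))).
  pose proof (exp_pos (eta * (b - x))); nra. }
(* The constants multiply to [6 * 3 * 2], which is the square of the announced 6. *)
destruct (HB x Hx) as [B1 _]; destruct (HB b ltac:(lra)) as [_ B2].
pose proof (norm1_ge_0 (psi x)); pose proof (norm1_ge_0 (psi b)); nra.
Qed.

Variable c : vec.

Let B : R := norm1_2 c.

(* First-order WKB approximation, as [k] grows, to the solution with
   components [(0, c) exp (- i k x)] in the limit. *)
Definition wkb (x : R) : vec := fun i =>
  (cis (- k * x) *
   match i with
   | 0%nat => RtoC (/ (2 * k)) * (Cconj (q x 0%nat) * c 0%nat + Cconj (q x 1%nat) * c 1%nat)
   | S j => c j
   end)%C.

Let residual (x : R) : vec := fun i =>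
  match i with
  | 0%nat => cis (- k * x) * (RtoC (/ (2 * k)) *
      (Cconj (qx x 0%nat) * c 0%nat + Cconj (qx x 1%nat) * c 1%nat))
  | S j => - (Ci * q x j * wkb x 0%nat)
  end%C.

(** The factor [1 / (2 k)] is chosen so that [- 2 i k] times the first component cancels the
    coupling to the last two. The defect is then the derivative of the slow amplitude in the first
    component, and the feedback of that component on the others; both are of order [1 / k]. *)
Lemma wkb_derive (x : R) (i : nat) : (i < 3)%nat ->
  is_derive (fun y => wkb y i) x (mvmul (Xm k (q x)) (wkb x) i + residual x i)%C.
Proof.
intros Hi.
pose proof (Hq x 0%nat ltac:(lia)) as Q0; pose proof (Hq x 1%nat ltac:(lia)) as Q1.
pose proof (is_derive_cis (- k) x) as Hcis.
destruct i as [|[|[|i]]]; [| | | lia]; unfold wkb at 1;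
  (evar_last; [derive_C|]); unfold residual, wkb, mvmul, Xm, madd, mscale, Jm, Qm, cr, Ci;
  clear -Hk; generalize (cis (- k * x)); intros [e f]; generalize_components;
  apply injective_projections;
  cbn [fst snd Cplus Cmult Cminus Copp Cconj RtoC]; field; lra.
Qed.

Lemma wkb_0_le (x : R) : a <= x <= b -> Cmod (wkb x 0%nat) <= M * B / (2 * k).
Proof.
intros Hx; destruct (HM x Hx) as [H1 _].
unfold wkb; rewrite !Cmod_mult, Cmod_cis, Cmod_R, Rabs_pos_eq
  by (left; apply Rinv_0_lt_compat; lra).
pose proof (Cmod_bilinear_le (q x 0%nat) (q x 1%nat) (c 0%nat) (c 1%nat)) as H2.
assert (0 <= B) by apply norm1_2_ge_0.
unfold Rdiv; rewrite Rmult_1_l, Rmult_comm; apply Rmult_le_compat_r;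
  [left; apply Rinv_0_lt_compat; lra|].
apply Rle_trans with (1 := H2). fold (norm1_2 (q x)) (norm1_2 c). fold B.
apply Rmult_le_compat_r; lra.
Qed.

Lemma residual_le (x : R) : a <= x <= b ->
  norm1 (residual x) <= M * B / (2 * k) * (1 + M).
Proof.
intros Hx; destruct (HM x Hx) as [H1 H2].
unfold norm1, residual.
rewrite !Cmod_opp, !(Cmod_mult (Ci * _)), !(Cmod_mult Ci), Cmod_Ci.
rewrite (Cmod_mult (cis _)), Cmod_cis, (Cmod_mult (RtoC _)), Cmod_R, Rabs_pos_eq
  by (left; apply Rinv_0_lt_compat; lra).
pose proof (wkb_0_le x Hx) as H3; pose proof (Cmod_ge_0 (wkb x 0%nat)).
pose proof (Cmod_bilinear_le (qx x 0%nat) (qx x 1%nat) (c 0%nat) (c 1%nat)) as H4.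
assert (0 <= B) by apply norm1_2_ge_0.
assert (H5 : / (2 * k) * Cmod (Cconj (qx x 0%nat) * c 0%nat + Cconj (qx x 1%nat) * c 1%nat)
  <= M * B / (2 * k)).
{ unfold Rdiv; rewrite Rmult_comm; apply Rmult_le_compat_r;
    [left; apply Rinv_0_lt_compat; lra|].
  apply Rle_trans with (1 := H4); fold (norm1_2 (qx x)) (norm1_2 c); fold B.
  apply Rmult_le_compat_r; lra. }
unfold norm1_2 in H1.
pose proof (Cmod_ge_0 (q x 0%nat)); pose proof (Cmod_ge_0 (q x 1%nat)).
set (X := M * B / (2 * k)) in *.
assert ((Cmod (q x 0%nat) + Cmod (q x 1%nat)) * Cmod (wkb x 0%nat) <= M * X)
  by (apply Rmult_le_compat; lra).
lra.
Qed.

(** [psi] is an exact solution, so the pairing varies only through [residual], and its total change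
    over the segment is of order [1 / k]. *)
Lemma wkb_pairing (P : R) :
  12 * M / k * (b - a) <= 1 -> norm1 (psi b) <= P ->
  Cmod (dotJ (wkb b) (psi b) - dotJ (wkb a) (psi a))
  <= 2 * (M * B / (2 * k) * (1 + M) * (6 * P)) * (b - a).
Proof.
intros Hsmall HP.
apply (mean_value_ineq_C (fun x => dotJ (wkb x) (psi x))
  (fun x => dotJ (residual x) (psi x))); [exact Hab | |]; intros x Hx.
- apply (dotJ_derive k x (q x) wkb psi (residual x)); [apply wkb_derive | apply Hpsi].
- eapply Rle_trans; [apply Cmod_dotJ_le|].
  apply Rmult_le_compat; try apply norm1_ge_0; [now apply residual_le|].
  pose proof (solution_bound Hsmall x Hx); lra.
Qed.

End Middle.

(** * Transport of the orthogonality from [- L] to [L] *)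

Lemma dotJ_vsub_l (u v w : vec) : dotJ (vsub u v) w = (dotJ u w - dotJ v w)%C.
Proof. unfold dotJ, vsub; rewrite !Cminus_conj; ring. Qed.

Lemma dotJ_vsub_r (u v w : vec) : dotJ u (vsub v w) = (dotJ u v - dotJ u w)%C.
Proof. unfold dotJ, vsub; ring. Qed.

Definition plane_wave (k : R) (c : vec) (x : R) : vec := fun i =>
  (cis (- k * x) * match i with 0%nat => RtoC 0 | S j => c j end)%C.

Lemma norm1_plane_wave (k : R) (c : vec) (x : R) : norm1 (plane_wave k c x) = norm1_2 c.
Proof.
unfold norm1, norm1_2, plane_wave; rewrite !Cmod_mult, !Cmod_cis, Cmod_0; ring.
Qed.

(** At [- L] the form of [chi] and [psi] vanishes. There [chi] is replaced by the plane wave and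
    then by [wkb]; the pairing of [wkb] with [psi] is carried to [L], where both are replaced by
    their asymptotic waves. Each replacement costs one term of the bound. *)
Lemma overlap_bound (k L M P eps th : R) (q qx psi : R -> vec) (c d w chi : vec) :
  0 < k -> 0 <= L -> 4 * M <= k -> 12 * M / k * (L - - L) <= 1 ->
  (forall x, - L <= x <= L -> norm1_2 (q x) <= M /\ norm1_2 (qx x) <= M) ->
  (forall x j, (j < 2)%nat -> is_derive (fun y => q y j) x (qx x j)) ->
  (forall x i, (i < 3)%nat ->
    is_derive (fun y => psi y i) x (mvmul (Xm k (q x)) (psi x) i)) ->
  norm1 (psi L) <= P ->
  (forall j, (j < 2)%nat -> w (S j) = (cis th * d j)%C) ->
  norm1 (vsub (psi L) w) <= eps ->
  norm1 (vsub chi (plane_wave k c (- L))) <= eps ->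
  dotJ chi (psi (- L)) = RtoC 0 ->
  Cmod (herm c d) <= M * norm1_2 c / (2 * k) * (24 * L * (1 + M) * P + 7 * P)
                     + (6 * P + norm1_2 c) * eps.
Proof.
intros Hk HL HMk Hsmall HM Hq Hpsi HP Hw HpsiL Hchi Hzero.
set (L' := - L) in *.
assert (HLL : L' <= L) by (unfold L'; lra).
pose proof (wkb_pairing k L' L M q qx psi Hk HLL HM HMk Hq Hpsi c P Hsmall HP) as H1.
pose proof (solution_bound k L' L M q qx psi Hk HLL HM HMk Hq Hpsi Hsmall L' ltac:(lra)) as H2.
set (X := M * norm1_2 c / (2 * k)) in *.
assert (Hwp : forall x, L' <= x <= L ->
  norm1 (vsub (wkb k q c x) (plane_wave k c x)) <= X).
{ intros x Hx; pose proof (wkb_0_le k L' L M q qx Hk HM c x Hx) as H3.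
  unfold norm1, vsub.
  replace (wkb k q c x 1%nat - plane_wave k c x 1%nat)%C with (RtoC 0)
    by (unfold wkb, plane_wave; ring).
  replace (wkb k q c x 2%nat - plane_wave k c x 2%nat)%C with (RtoC 0)
    by (unfold wkb, plane_wave; ring).
  replace (wkb k q c x 0%nat - plane_wave k c x 0%nat)%C with (wkb k q c x 0%nat)
    by (unfold plane_wave; ring).
  rewrite Cmod_0; fold X in H3; lra. }
(* The plane wave has first component 0, so the form sees the last two components of [w] only; the
   sign and the phases disappear in the modulus. *)
assert (Hherm : Cmod (herm c d) = Cmod (dotJ (plane_wave k c L) w)).
{ replace (dotJ (plane_wave k c L) w)
    with (- (Cconj (cis (- k * L)) * cis th * herm c d))%C.
  - rewrite Cmod_opp, !Cmod_mult, Cmod_conj, !Cmod_cis; ring.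
  - unfold dotJ, plane_wave, herm; rewrite !Cmult_conj, !Hw by lia.
    replace (Cconj (RtoC 0)) with (RtoC 0) by (apply injective_projections; simpl; ring).
    ring. }
rewrite Hherm.
replace (dotJ (plane_wave k c L) w) with
  ((dotJ (wkb k q c L) (psi L) - dotJ (wkb k q c L') (psi L'))
   + (dotJ (vsub (wkb k q c L') (plane_wave k c L')) (psi L')
      - dotJ (vsub chi (plane_wave k c L')) (psi L'))
   - dotJ (vsub (wkb k q c L) (plane_wave k c L)) (psi L)
   - dotJ (plane_wave k c L) (vsub (psi L) w))%C
  by (rewrite !dotJ_vsub_l, !dotJ_vsub_r, Hzero; ring).
assert (HP0 : 0 <= P) by (pose proof (norm1_ge_0 (psi L)); lra).
assert (K1 : Cmod (dotJ (vsub (wkb k q c L') (plane_wave k c L')) (psi L')) <= X * (6 * P)).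
{ eapply Rle_trans; [apply Cmod_dotJ_le|].
  apply Rmult_le_compat; try apply norm1_ge_0; [apply Hwp|]; lra. }
assert (K2 : Cmod (dotJ (vsub chi (plane_wave k c L')) (psi L')) <= eps * (6 * P)).
{ eapply Rle_trans; [apply Cmod_dotJ_le|].
  apply Rmult_le_compat; try apply norm1_ge_0; lra. }
assert (K3 : Cmod (dotJ (vsub (wkb k q c L) (plane_wave k c L)) (psi L)) <= X * P).
{ eapply Rle_trans; [apply Cmod_dotJ_le|].
  apply Rmult_le_compat; try apply norm1_ge_0; [apply Hwp|]; lra. }
assert (K4 : Cmod (dotJ (plane_wave k c L) (vsub (psi L) w)) <= norm1_2 c * eps).
{ eapply Rle_trans; [apply Cmod_dotJ_le|]; rewrite norm1_plane_wave.
  apply Rmult_le_compat_l; [apply norm1_2_ge_0 | lra]. }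
eapply Rle_trans; [apply Cmod_minus_le|].
eapply Rle_trans; [apply Rplus_le_compat_r, Cmod_minus_le|].
eapply Rle_trans; [apply Rplus_le_compat_r, Rplus_le_compat_r, Cmod_triangle|].
eapply Rle_trans; [do 2 apply Rplus_le_compat_r; apply Rplus_le_compat_l, Cmod_minus_le|].
replace (L - L') with (2 * L) in H1 by (unfold L'; ring).
lra.
Qed.

(** * Vanishing of the conserved form from its asymptotics *)

Lemma dotJ_lim (F : (R -> Prop) -> Prop) {FF : Filter F} (u u0 w w0 : R -> vec) (W : R) :
  (forall i, (i < 3)%nat -> filterlim (fun x => u x i - u0 x i)%C F (locally (RtoC 0))) ->
  (forall i, (i < 3)%nat -> filterlim (fun x => w x i - w0 x i)%C F (locally (RtoC 0))) ->
  (forall x, norm1 (u0 x) <= W) -> (forall x, norm1 (w0 x) <= W) ->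
  (forall x, dotJ (u0 x) (w0 x) = RtoC 0) ->
  forall e, 0 < e -> F (fun x => Cmod (dotJ (u x) (w x)) < e).
Proof.
intros Hu Hw Bu Bw H0 e He.
assert (HW : 0 <= W) by (pose proof (norm1_ge_0 (u0 0)); pose proof (Bu 0); lra).
set (d := Rmin 1 (e / (2 * W + 2)) / 3).
assert (Hd : 0 < d).
{ unfold d; apply Rdiv_lt_0_compat; [apply Rmin_pos|]; try lra. apply Rdiv_lt_0_compat; lra. }
assert (Hn : forall v v0 : R -> vec,
  (forall i, (i < 3)%nat -> filterlim (fun x => v x i - v0 x i)%C F (locally (RtoC 0))) ->
  F (fun x => norm1 (vsub (v x) (v0 x)) < 3 * d)).
{ intros v v0 Hv.
  pose proof (filterlim_Cmod_lt F _ d (Hv 0%nat ltac:(lia)) Hd) as K0.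
  pose proof (filterlim_Cmod_lt F _ d (Hv 1%nat ltac:(lia)) Hd) as K1.
  pose proof (filterlim_Cmod_lt F _ d (Hv 2%nat ltac:(lia)) Hd) as K2.
  generalize (filter_and _ _ K0 (filter_and _ _ K1 K2)).
  apply filter_imp; intros x [J0 [J1 J2]]; unfold norm1, vsub; lra. }
generalize (filter_and _ _ (Hn u u0 Hu) (Hn w w0 Hw)); apply filter_imp; intros x [K1 K2].
replace (dotJ (u x) (w x)) with
  (dotJ (vsub (u x) (u0 x)) (vsub (w x) (w0 x)) + dotJ (vsub (u x) (u0 x)) (w0 x)
   + dotJ (u0 x) (vsub (w x) (w0 x)))%C
  by (rewrite !dotJ_vsub_l, !dotJ_vsub_r, H0; ring).
assert (D1 : 3 * d <= 1 /\ 3 * d * (2 * W + 2) <= e).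
{ unfold d; replace (3 * (_ / 3)) with (Rmin 1 (e / (2 * W + 2))) by field.
  split; [apply Rmin_l|].
  apply Rle_trans with (e / (2 * W + 2) * (2 * W + 2)).
  - apply Rmult_le_compat_r; [lra | apply Rmin_r].
  - right; field; lra. }
eapply Rle_lt_trans; [apply Cmod_triangle|].
eapply Rle_lt_trans; [apply Rplus_le_compat_r, Cmod_triangle|].
pose proof (Cmod_dotJ_le (vsub (u x) (u0 x)) (vsub (w x) (w0 x))) as M1.
pose proof (Cmod_dotJ_le (vsub (u x) (u0 x)) (w0 x)) as M2.
pose proof (Cmod_dotJ_le (u0 x) (vsub (w x) (w0 x))) as M3.
pose proof (Bu x); pose proof (Bw x).
pose proof (norm1_ge_0 (u0 x)); pose proof (norm1_ge_0 (w0 x)).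
pose proof (norm1_ge_0 (vsub (u x) (u0 x))); pose proof (norm1_ge_0 (vsub (w x) (w0 x))).
set (n1 := norm1 (vsub (u x) (u0 x))) in *; set (n2 := norm1 (vsub (w x) (w0 x))) in *.
set (n3 := norm1 (u0 x)) in *; set (n4 := norm1 (w0 x)) in *; clearbody n1 n2 n3 n4.
assert (n1 * n2 <= 3 * d * 1) by (apply Rmult_le_compat; lra).
assert (n1 * n4 <= 3 * d * W) by (apply Rmult_le_compat; lra).
assert (n3 * n2 <= W * (3 * d)) by (apply Rmult_le_compat; lra).
lra.
Qed.

(** The form is constant in [x] and tends to 0 at minus infinity, because the asymptotic waves are
    bounded and orthogonal for it. *)
Lemma conserved_dotJ_zero (k : R) (q u u0 w w0 : R -> vec) (W : R) :
  (forall x i, (i < 3)%nat -> is_derive (fun y => u y i) x (mvmul (Xm k (q x)) (u x) i)) ->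
  (forall x i, (i < 3)%nat -> is_derive (fun y => w y i) x (mvmul (Xm k (q x)) (w x) i)) ->
  (forall i, (i < 3)%nat ->
    filterlim (fun x => u x i - u0 x i)%C (Rbar_locally m_infty) (locally (RtoC 0))) ->
  (forall i, (i < 3)%nat ->
    filterlim (fun x => w x i - w0 x i)%C (Rbar_locally m_infty) (locally (RtoC 0))) ->
  (forall x, norm1 (u0 x) <= W) -> (forall x, norm1 (w0 x) <= W) ->
  (forall x, dotJ (u0 x) (w0 x) = RtoC 0) ->
  forall x, dotJ (u x) (w x) = RtoC 0.
Proof.
intros Hu Hw Lu Lw Bu Bw H0.
assert (Hconst : forall x y, x <= y -> dotJ (u x) (w x) = dotJ (u y) (w y)).
{ intros x y Hxy.
  assert (H : Cmod (dotJ (u y) (w y) - dotJ (u x) (w x)) <= 2 * 0 * (y - x)).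
  { apply (mean_value_ineq_C (fun x => dotJ (u x) (w x)) (fun _ => RtoC 0)); [exact Hxy | |].
    - intros t _; evar_last.
      + apply (dotJ_derive k t (q t) u w (fun _ => RtoC 0)); [|apply Hw].
        intros i Hi; rewrite Cplus_0_r; now apply Hu.
      + unfold dotJ; apply injective_projections; simpl; ring.
    - intros t _; rewrite Cmod_0; lra. }
  pose proof (Cmod_ge_0 (dotJ (u y) (w y) - dotJ (u x) (w x))).
  assert (Heq : (dotJ (u y) (w y) - dotJ (u x) (w x))%C = RtoC 0) by (apply Cmod_eq_0; lra).
  replace (dotJ (u y) (w y)) with (dotJ (u x) (w x) + (dotJ (u y) (w y) - dotJ (u x) (w x)))%C by ring.
  rewrite Heq; ring. }
intros x; apply Cmod_eq_0.
destruct (Rle_or_lt (Cmod (dotJ (u x) (w x))) 0) as [H|H];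
  [pose proof (Cmod_ge_0 (dotJ (u x) (w x))); lra|exfalso].
destruct (dotJ_lim (Rbar_locally m_infty) u u0 w w0 W Lu Lw Bu Bw H0 _ H) as [A HA].
(* This point lies to the left of [x] and inside the neighbourhood of minus infinity given by
   [A]. *)
pose proof (HA (Rmin x (A - 1))) as HA1.
pose proof (Rmin_l x (A - 1)); pose proof (Rmin_r x (A - 1)).
rewrite (Hconst (Rmin x (A - 1)) x) in HA1 by lra.
specialize (HA1 ltac:(lra)); lra.
Qed.

(** * Continuity and rescaling of solutions *)

Lemma continuous_Cmod (f : R -> C) (x : R) :
  continuous f x -> continuous (fun y => Cmod (f y)) x.
Proof.
intros Hf; apply (filterlim_comp _ _ _ f Cmod _ _ _ Hf).
apply (filterlim_norm (V := C_NormedModule)).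
Qed.

Lemma is_derive_C_continuous (f : R -> C) (x : R) (l : C) :
  is_derive f x l -> continuous f x.
Proof. intros Hf; apply (ex_derive_continuous (K := R_AbsRing)
  (V := prod_NormedModule _ R_NormedModule R_NormedModule)); eexists; exact Hf. Qed.

Lemma filterlim_C_scal (F : (R -> Prop) -> Prop) {FF : Filter F} (c : C) (f : R -> C) :
  filterlim f F (locally (RtoC 0)) -> filterlim (fun x => c * f x)%C F (locally (RtoC 0)).
Proof.
intros Hf.
replace (RtoC 0) with (scal c (RtoC 0)) by (cbv; apply injective_projections; cbn; ring).
apply (filterlim_comp _ _ _ f (scal c) _ _ _ Hf).
apply (filterlim_scal_r (K := C_AbsRing) (V := C_NormedModule)).
Qed.

Lemma mvmul_scal (A : mat) (a : C) (u : vec) (i : nat) :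
  mvmul A (fun i => a * u i)%C i = (a * mvmul A u i)%C.
Proof. unfold mvmul; ring. Qed.

Lemma scal_solution (A : R -> mat) (a : C) (u : R -> vec) :
  (forall x i, (i < 3)%nat -> is_derive (fun y => u y i) x (mvmul (A x) (u x) i)) ->
  forall x i, (i < 3)%nat ->
    is_derive (fun y => a * u y i)%C x (mvmul (A x) (fun i => a * u x i)%C i).
Proof.
intros Hu x i Hi; pose proof (Hu x i Hi) as U.
evar_last; [derive_C|]. rewrite mvmul_scal; ring.
Qed.

(** * Explicit waves for the constant backgrounds *)

Lemma Yhat_expiDelta (sigma q0 z x : R) (v : vec) (i : nat) :
  mmul (Yhat q0 z v) (expiDelta sigma q0 z x 0) i 0%nat = (cis (lz q0 z * x) * Yhat q0 z v i 0%nat)%C /\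
  mmul (Yhat q0 z v) (expiDelta sigma q0 z x 0) i 1%nat = (cis (- kz q0 z * x) * Yhat q0 z v i 1%nat)%C /\
  mmul (Yhat q0 z v) (expiDelta sigma q0 z x 0) i 2%nat = (cis (- lz q0 z * x) * Yhat q0 z v i 2%nat)%C.
Proof.
unfold mmul, expiDelta, cr.
replace (delta1 sigma q0 z x 0) with (lz q0 z * x) by (unfold delta1; ring).
replace (delta2 sigma q0 z x 0) with (- kz q0 z * x) by (unfold delta2; ring).
replace (- lz q0 z * x) with (- (lz q0 z * x)) by ring.
repeat split; ring.
Qed.

Lemma norm1_phase (a : R) (u : vec) : norm1 (fun i => cis a * u i)%C = norm1 u.
Proof. unfold norm1; rewrite !Cmod_mult, !Cmod_cis; ring. Qed.

(** Expansion of [u] in the orthogonal basis formed by [v] and [vperp v]. It turns non-parallel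
    boundary values into a nonzero overlap of [vperp qm] with [qp]. *)
Lemma Lagrange_identity (u v : vec) :
  Cmod (herm (vperp v) u) ^ 2 + Cmod (herm u v) ^ 2 = nrm2 u * nrm2 v.
Proof.
unfold nrm2; rewrite !Cmod2_alt; unfold herm, vperp; generalize_components.
cbn [fst snd Cplus Cmult Cminus Copp Cconj RtoC Re Im]; ring.
Qed.

Lemma nrm2_of_sqrt (v : vec) (a : R) : sqrt (nrm2 v) = a -> nrm2 v = a ^ 2.
Proof.
intros <-; rewrite pow2_sqrt; [reflexivity|].
unfold nrm2; apply Rplus_le_le_0_compat; apply pow2_ge_0.
Qed.

(** The first column of [Yhat] with its phase, divided by [i * rhohat / z]. In this scaling the
    amplitude tends to [(0, v)], not to 0, as [z] tends to [0+]. *)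
Definition lambda_wave (q0 z : R) (v : vec) (x : R) : vec := fun i =>
  (cis (lz q0 z * x) * match i with 0%nat => RtoC z | S j => v j end)%C.

(** [(z, v)] is an eigenvector of [k J + Q] for the eigenvalue [lz q0 z], by [k + lambda = z] and
    [k - lambda = q0 ^ 2 / z]. *)
Lemma lambda_wave_derive (q0 z : R) (v : vec) (x : R) (i : nat) :
  z <> 0 -> nrm2 v = q0 ^ 2 -> (i < 3)%nat ->
  is_derive (fun y => lambda_wave q0 z v y i) x
    (mvmul (Xm (kz q0 z) v) (lambda_wave q0 z v x) i).
Proof.
intros Hz Hv Hi.
assert (Hv' : (Cconj (v 0%nat) * v 0%nat + Cconj (v 1%nat) * v 1%nat)%C = RtoC (q0 ^ 2)).
{ rewrite <- Hv; unfold nrm2; rewrite RtoC_plus, !Cmod2_conj; ring. }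
assert (H1 : (RtoC (lz q0 z) * RtoC z)%C = (RtoC (kz q0 z) * RtoC z - RtoC (q0 ^ 2))%C).
{ rewrite <- !RtoC_mult, <- RtoC_minus; f_equal; unfold lz, kz; field; exact Hz. }
assert (H2 : RtoC (lz q0 z) = (RtoC z - RtoC (kz q0 z))%C).
{ rewrite <- RtoC_minus; f_equal; unfold lz, kz; field; exact Hz. }
pose proof (is_derive_cis (lz q0 z) x) as Hcis.
unfold lambda_wave; destruct i as [|[|[|i]]]; [| | | lia];
  (evar_last; [derive_C|]); unfold mvmul, Xm, madd, mscale, Jm, Qm, cr;
  set (e := cis (lz q0 z * x)) in *; clearbody e.
- transitivity (Ci * e * (RtoC (lz q0 z) * RtoC z))%C; [ring|]; rewrite H1, <- Hv'; ring.
- rewrite H2; replace (RtoC (-1)) with (- RtoC 1)%C by (rewrite <- RtoC_opp; reflexivity); ring.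
- rewrite H2; replace (RtoC (-1)) with (- RtoC 1)%C by (rewrite <- RtoC_opp; reflexivity); ring.
Qed.

(** [vperp v] is orthogonal to [v], so [(0, vperp v)] is an eigenvector of [k J + Q] for the
    eigenvalue [- k]. *)
Lemma plane_wave_derive (k : R) (v : vec) (x : R) (i : nat) :
  (i < 3)%nat ->
  is_derive (fun y => plane_wave k (vperp v) y i) x
    (mvmul (Xm k v) (plane_wave k (vperp v) x) i).
Proof.
intros Hi.
pose proof (is_derive_cis (- k) x) as Hcis.
unfold plane_wave, vperp; destruct i as [|[|[|i]]]; [| | | lia];
  (evar_last; [derive_C|]); unfold mvmul, Xm, madd, mscale, Jm, Qm, cr;
  replace (RtoC (-1)) with (- RtoC 1)%C by (rewrite <- RtoC_opp; reflexivity);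
  replace (Cconj (RtoC 0)) with (RtoC 0) by (apply injective_projections; simpl; ring);
  rewrite ?RtoC_opp; ring.
Qed.

(** * Tools for choosing [L] and then [k] *)

Lemma weight_primitive (Q : R -> vec) (c : vec) :
  (forall x j, (j < 2)%nat -> continuous (fun y => Q y j) x) ->
  exists E, (forall x, is_derive E x (norm1_2 (vsub (Q x) c))) /\
   ((forall j, (j < 2)%nat ->
      ex_RInt_gen (fun x => Cmod (Q x j - c j)) (at_point 0) (Rbar_locally p_infty)) ->
     exists l, filterlim E (Rbar_locally p_infty) (locally l)) /\
   ((forall j, (j < 2)%nat ->
      ex_RInt_gen (fun x => Cmod (Q x j - c j)) (Rbar_locally m_infty) (at_point 0)) ->
     exists l, filterlim E (Rbar_locally m_infty) (locally l)).
Proof.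
intros HQ.
assert (Hc : forall j, (j < 2)%nat -> forall x, continuous (fun x => Cmod (Q x j - c j)) x).
{ intros j Hj x; apply (continuous_Cmod (fun x => Q x j - c j)%C).
  apply (continuous_minus (V := prod_NormedModule _ R_NormedModule R_NormedModule)
    (fun x => Q x j) (fun _ => c j)); [now apply HQ | apply continuous_const]. }
destruct (primitive_of_integrable _ (Hc 0%nat ltac:(lia))) as [E0 [D0 [P0 M0]]].
destruct (primitive_of_integrable _ (Hc 1%nat ltac:(lia))) as [E1 [D1 [P1 M1]]].
exists (fun x => E0 x + E1 x); split; [|split].
- intros x; apply (is_derive_plus (V := R_NormedModule) E0 E1); [apply D0 | apply D1].
- intros H; destruct (P0 (H 0%nat ltac:(lia))) as [l0 L0].
  destruct (P1 (H 1%nat ltac:(lia))) as [l1 L1]; exists (l0 + l1).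
  apply (filterlim_comp_2 _ _ plus L0 L1), (filterlim_plus (V := R_NormedModule)).
- intros H; destruct (M0 (H 0%nat ltac:(lia))) as [l0 L0].
  destruct (M1 (H 1%nat ltac:(lia))) as [l1 L1]; exists (l0 + l1).
  apply (filterlim_comp_2 _ _ plus L0 L1), (filterlim_plus (V := R_NormedModule)).
Qed.

(** The sign [a] serves both ends: [-1] at plus infinity, [1] at minus infinity. *)
Lemma tail_small (F : (R -> Prop) -> Prop) {FF : Filter F} (E : R -> R) (l a W e : R) :
  filterlim E F (locally l) -> 0 < e ->
  F (fun x => 6 * (W ^ 2 * (exp (36 * (a * (E x - l))) - 1)) < e).
Proof.
intros HE He.
assert (Hg : continuous (fun s => 6 * (W ^ 2 * (exp (36 * (a * (s - l))) - 1))) l).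
{ apply (ex_derive_continuous (K := R_AbsRing) (V := R_NormedModule)); auto_derive; exact I. }
pose proof (filterlim_comp _ _ _ E _ _ _ _ HE Hg) as H.
pose proof (proj1 (filterlim_locally (U := R_UniformSpace) _ _) H (mkposreal e He)) as H1.
revert H1; apply filter_imp; intros x Hx.
change (Rabs (6 * (W ^ 2 * (exp (36 * (a * (E x - l))) - 1))
  - 6 * (W ^ 2 * (exp (36 * (a * (l - l))) - 1))) < e) in Hx.
replace (36 * (a * (l - l))) with 0 in Hx by ring; rewrite exp_0 in Hx.
apply Rabs_def2 in Hx; lra.
Qed.

Lemma bounded_on_segment (Q : R -> vec) (a b : R) :
  a <= b -> (forall x j, (j < 2)%nat -> continuous (fun y => Q y j) x) ->
  exists M, forall x, a <= x <= b -> norm1_2 (Q x) <= M.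
Proof.
intros Hab HQ.
destruct (continuity_ab_maj (fun x => norm1_2 (Q x)) a b Hab) as [y [Hy _]].
- intros x _; apply continuity_pt_filterlim.
  apply (continuous_plus (V := R_NormedModule) (fun x => Cmod (Q x 0%nat)) (fun x => Cmod (Q x 1%nat)));
    apply continuous_Cmod, HQ; lia.
- now exists (norm1_2 (Q y)).
Qed.

Lemma exists_large_kz (q0 K : R) : 0 < q0 -> q0 <= K ->
  exists z, 0 < z < q0 /\ K <= kz q0 z.
Proof.
(* For this [z] the term [q0 ^ 2 / z] equals [2 * K], and half of it already gives [K]. *)
intros Hq0 HK; exists (q0 ^ 2 / (2 * K)).
assert (H : 0 < q0 ^ 2 / (2 * K)) by (apply Rdiv_lt_0_compat; nra).
split; [split; [exact H|]|].
- apply (Rmult_lt_reg_r (2 * K)); [lra|]. field_simplify; [nra | lra].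
- unfold kz; replace (q0 ^ 2 / (q0 ^ 2 / (2 * K))) with (2 * K) by (field; lra); lra.
Qed.

Lemma Rdiv_le_of_mult_le (a b c : R) : 0 < b -> a <= c * b -> a / b <= c.
Proof.
intros Hb H; apply (Rmult_le_reg_r b); [exact Hb|].
unfold Rdiv; rewrite Rmult_assoc, Rinv_l by lra; lra.
Qed.

(** * Orthogonality and asymptotics of the Jost columns at [t = 0] *)

Section Jost.

Variables (q0 sigma : R) (q qx qxx : nat -> R -> R -> C) (qp qm : vec).
Variables (psip psim : R -> R -> R -> mat) (H Sm : R -> mat).
Hypothesis Hq0 : 0 < q0.
Hypothesis Hsolp : lax_solution sigma q0 q qx qxx psip.
Hypothesis Hsolm : lax_solution sigma q0 q qx qxx psim.
Hypothesis Hasp : jost_asymptotics sigma q0 qp (Rbar_locally p_infty) psip.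
Hypothesis Hasm : jost_asymptotics sigma q0 qm (Rbar_locally m_infty) psim.
Hypothesis Hsc : scattering q0 psip psim H Sm.

Variable z : R.
Hypothesis Hz : 0 < z < q0.

Let k := kz q0 z.
Let Q (x : R) : vec := fun j => q j x 0.

Lemma zdom_z : zdom q0 z.
Proof. unfold zdom; repeat split; lra. Qed.

Lemma column_solution (psi : R -> R -> R -> mat) (j : nat) :
  lax_solution sigma q0 q qx qxx psi -> (j < 3)%nat ->
  forall x i, (i < 3)%nat ->
    is_derive (fun y => psi z y 0 i j) x (mvmul (Xm k (Q x)) (fun i => psi z x 0 i j) i).
Proof. intros Hsol Hj x i Hi; exact (proj1 (Hsol z x 0 i j zdom_z Hi Hj)). Qed.

(** At minus infinity the second column is proportional to [(0, vperp qm)], while the last two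
    components of the other columns are multiples of [qm]. *)
Lemma dotJ_column_zero (j : nat) : j = 0%nat \/ j = 2%nat ->
  forall x, dotJ (fun i => psim z x 0 i 1%nat) (fun i => psim z x 0 i j) = RtoC 0.
Proof.
intros Hj.
set (Y := fun j => fun i => Yhat q0 z qm i j).
set (th := fun j => match j with 0%nat => lz q0 z | _ => - lz q0 z end).
set (W := norm1 (Y 0%nat) + norm1 (Y 1%nat) + norm1 (Y 2%nat)).
pose proof (norm1_ge_0 (Y 0%nat)); pose proof (norm1_ge_0 (Y 1%nat)).
pose proof (norm1_ge_0 (Y 2%nat)).
assert (Hj3 : (j < 3)%nat) by lia.
apply (conserved_dotJ_zero k Q
  (fun x i => psim z x 0 i 1%nat) (fun x i => cis (- k * x) * Y 1%nat i)%C
  (fun x i => psim z x 0 i j) (fun x i => cis (th j * x) * Y j i)%C W).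
- apply column_solution; [exact Hsolm | lia].
- apply column_solution; [exact Hsolm | exact Hj3].
- intros i Hi; apply (filterlim_ext _ _ (fun x => f_equal (Cminus _)
    (proj1 (proj2 (Yhat_expiDelta sigma q0 z x qm i))))).
  apply (Hasm z 0 i 1%nat zdom_z Hi); lia.
- intros i Hi; destruct Hj as [-> | ->].
  + apply (filterlim_ext _ _ (fun x => f_equal (Cminus _)
      (proj1 (Yhat_expiDelta sigma q0 z x qm i)))).
    apply (Hasm z 0 i 0%nat zdom_z Hi); lia.
  + apply (filterlim_ext _ _ (fun x => f_equal (Cminus _)
      (proj2 (proj2 (Yhat_expiDelta sigma q0 z x qm i))))).
    apply (Hasm z 0 i 2%nat zdom_z Hi); lia.
- intros x; rewrite norm1_phase; unfold W; lra.
- intros x; rewrite norm1_phase; unfold W; destruct Hj as [-> | ->]; lra.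
- intros x; unfold dotJ, Y, Yhat, vperp, Cdiv, cr.
  destruct Hj as [-> | ->]; rewrite !Cmult_conj, ?Copp_conj, ?Cconj_conj;
    replace (Cconj (RtoC 0)) with (RtoC 0) by (apply injective_projections; simpl; ring);
    rewrite ?Copp_conj, ?Cconj_conj; ring.
Qed.

(** With [h21 = 0] the first column of [psi_+] combines only the first and third columns of [psi_-],
    both orthogonal to the second. *)
Lemma dotJ_scattering_zero : H z 1%nat 0%nat = RtoC 0 ->
  forall x, dotJ (fun i => psim z x 0 i 1%nat) (fun i => psip z x 0 i 0%nat) = RtoC 0.
Proof.
intros HH x.
pose proof (dotJ_column_zero 0%nat ltac:(auto) x) as H0.
pose proof (dotJ_column_zero 2%nat ltac:(auto) x) as H2.
assert (Hp : forall i, (i < 3)%nat -> psip z x 0 i 0%nat =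
  (psim z x 0 i 0%nat * H z 0%nat 0%nat + psim z x 0 i 2%nat * H z 2%nat 0%nat)%C).
{ intros i Hi; rewrite (proj1 (Hsc z zdom_z) x 0 i 0%nat Hi) by lia.
  unfold mmul; rewrite HH; ring. }
transitivity (H z 0%nat 0%nat * dotJ (fun i => psim z x 0 i 1%nat) (fun i => psim z x 0 i 0%nat)
  + H z 2%nat 0%nat * dotJ (fun i => psim z x 0 i 1%nat) (fun i => psim z x 0 i 2%nat))%C.
- unfold dotJ; rewrite !Hp by lia; ring.
- rewrite H0, H2; ring.
Qed.

Lemma first_column_lim : exists a : C, forall i, (i < 3)%nat ->
  filterlim (fun x => a * psip z x 0 i 0%nat - lambda_wave q0 z qp x i)%C
    (Rbar_locally p_infty) (locally (RtoC 0)).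
Proof.
set (r := rhohat q0 z).
assert (Hr : RtoC r <> RtoC 0).
{ intros E; apply RtoC_inj in E; revert E; unfold r, rhohat.
  apply Rmult_integral_contrapositive_currified; [nra | apply Rinv_neq_0_compat; nra]. }
assert (Hz0 : RtoC z <> RtoC 0) by (intros E; apply RtoC_inj in E; lra).
(* The inverse of [i * rhohat / z], the normalization of [lambda_wave]. *)
exists (RtoC z / RtoC r * - Ci)%C; intros i Hi.
pose proof (filterlim_C_scal (Rbar_locally p_infty) (RtoC z / RtoC r * - Ci)%C _ (Hasp z 0 i 0%nat zdom_z Hi ltac:(lia))) as HL.
revert HL; apply filterlim_ext; intros x.
rewrite (proj1 (Yhat_expiDelta sigma q0 z x qp i)); unfold lambda_wave, Yhat; fold r; unfold cr.
assert (HC : (Ci * Ci)%C = (- RtoC 1)%C) by (apply injective_projections; simpl; ring).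
destruct i as [|i].
- transitivity (RtoC z / RtoC r * - Ci * psip z x 0 0%nat 0%nat
    + (Ci * Ci) * cis (lz q0 z * x) * RtoC z)%C; [field; auto | rewrite HC; ring].
- transitivity (RtoC z / RtoC r * - Ci * psip z x 0 (S i) 0%nat
    + (Ci * Ci) * cis (lz q0 z * x) * qp i)%C; [field; auto | rewrite HC; ring].
Qed.

Lemma second_column_lim (i : nat) : (i < 3)%nat ->
  filterlim (fun x => RtoC q0 * psim z x 0 i 1%nat - plane_wave k (vperp qm) x i)%C
    (Rbar_locally m_infty) (locally (RtoC 0)).
Proof.
intros Hi.
assert (Hq00 : RtoC q0 <> RtoC 0) by (intros E; apply RtoC_inj in E; lra).
pose proof (filterlim_C_scal (Rbar_locally m_infty) (RtoC q0) _ (Hasm z 0 i 1%nat zdom_z Hi ltac:(lia))) as HL.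
revert HL; apply filterlim_ext; intros x.
rewrite (proj1 (proj2 (Yhat_expiDelta sigma q0 z x qm i))).
fold k; unfold plane_wave, Yhat, cr; destruct i as [|i]; field; auto.
Qed.

(** A bound uniform in [z], so that the tail estimate holds with one [W] for all [z] below [q0]. *)
Lemma norm1_lambda_wave_le (x : R) : norm1 (lambda_wave q0 z qp x) <= q0 + norm1_2 qp.
Proof.
unfold lambda_wave; rewrite norm1_phase; unfold norm1, norm1_2.
rewrite Cmod_R, Rabs_pos_eq; lra.
Qed.

End Jost.

(** * The contradiction at one sufficiently large [k] *)

Theorem theorem3 :
  forall (q0 sigma : R) (q qx qxx qxxx qt : nat -> R -> R -> C) (qp qm : vec)
         (psip psim : R -> R -> R -> mat) (H Sm : R -> mat),
    0 < q0 ->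
    sqrt (nrm2 qp) = q0 ->
    sqrt (nrm2 qm) = q0 ->
    Cmod (herm qp qm) < q0 ^ 2 ->
    hirota_solution sigma q0 q qx qxx qxxx qt ->
    boundary_conditions q qp qm ->
    jost_pair sigma q0 q qx qxx qp qm psip psim ->
    scattering q0 psip psim H Sm ->
    ~ reflectionless q0 H Sm.
Proof.
intros q0 sigma q qx qxx qxxx qt qp qm psip psim H Sm Hq0 Hqp Hqm Hnp Hsol Hbc
  [Lp [Lm [Ap Am]]] Hsc Hrefl.
apply nrm2_of_sqrt in Hqp; apply nrm2_of_sqrt in Hqm.
set (Q := fun x : R => (fun j => q j x 0) : vec).
set (Qx := fun x : R => (fun j => qx j x 0) : vec).
assert (HQ : forall x j, (j < 2)%nat -> is_derive (fun y => Q y j) x (Qx x j)).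
{ intros x j Hj; exact (proj1 (Hsol j x 0 Hj)). }
assert (CQ : forall x j, (j < 2)%nat -> continuous (fun y => Q y j) x).
{ intros x j Hj; exact (is_derive_C_continuous _ _ _ (HQ x j Hj)). }
assert (CQx : forall x j, (j < 2)%nat -> continuous (fun y => Qx y j) x).
{ intros x j Hj; exact (is_derive_C_continuous _ _ _ (proj1 (proj2 (Hsol j x 0 Hj)))). }
destruct (weight_primitive Q qp CQ) as [Ep [DEp [Limp _]]].
destruct (weight_primitive Q qm CQ) as [Em [DEm [_ Limm]]].
destruct Limp as [lp Hlp]; [intros j Hj; apply (Hbc j 0 Hj)|].
destruct Limm as [lm Hlm]; [intros j Hj; apply (Hbc j 0 Hj)|].
set (c := vperp qm).
set (Wp := q0 + norm1_2 qp); set (P := Wp + 1); set (B := norm1_2 c).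
pose proof (norm1_2_ge_0 qp) as Hnp0; pose proof (norm1_2_ge_0 qm) as Hnm0.
pose proof (norm1_2_ge_0 c) as HB0; fold B in HB0.
assert (HD : 0 < Cmod (herm c qp)).
{ pose proof (Lagrange_identity qp qm) as HL; fold c in HL; rewrite Hqp, Hqm in HL.
  pose proof (Cmod_ge_0 (herm c qp)) as [HD|HD]; [exact HD|].
  rewrite <- HD in HL; pose proof (Cmod_ge_0 (herm qp qm)); nra. }
set (D := Cmod (herm c qp)) in *.
assert (HP : 1 <= P) by (unfold P, Wp; lra).
(* The final estimate reads [D <= eps + (6 * P + B) * eps], and this choice makes its right side at
   most [D / 2]. The cap 1 gives [norm1 (psi L) <= Wp + 1 = P]. *)
set (eps := Rmin 1 (D / (2 * (6 * P + B + 1)))).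
assert (Heps : 0 < eps /\ eps <= 1 /\ (6 * P + B + 1) * eps <= D / 2).
{ unfold eps; split; [|split; [apply Rmin_l|]].
  - apply Rmin_pos; [lra|]. apply Rdiv_lt_0_compat; lra.
  - apply Rle_trans with ((6 * P + B + 1) * (D / (2 * (6 * P + B + 1)))).
    + apply Rmult_le_compat_l; [lra | apply Rmin_r].
    + right; field; lra. }
destruct Heps as [Heps0 [Heps1 HepsD]].
assert (Heps2 : 0 < eps ^ 2) by (apply pow_lt; lra).
(* [Wp] and [B] do not depend on [z], so [L] is fixed here, before [z]. The tolerance is [eps ^ 2]
   because the tail estimates bound squares. *)
destruct (tail_small (Rbar_locally p_infty) Ep lp (-1) Wp _ Hlp Heps2) as [Tp HTp].
destruct (tail_small (Rbar_locally m_infty) Em lm 1 B _ Hlm Heps2) as [Tm HTm].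
set (L := Rabs Tp + Rabs Tm + 1).
assert (HL : 0 <= L /\ Tp < L /\ - L < Tm).
{ unfold L; pose proof (Rabs_pos Tp); pose proof (Rabs_pos Tm).
  pose proof (Rle_abs Tp); pose proof (Rle_abs (- Tm)); rewrite Rabs_Ropp in *; repeat split; lra. }
destruct HL as [HL0 [HLp HLm]].
specialize (HTp L HLp); specialize (HTm (- L) HLm).
destruct (bounded_on_segment Q (- L) L ltac:(lra) CQ) as [M0 HM0].
destruct (bounded_on_segment Qx (- L) L ltac:(lra) CQx) as [M1 HM1].
set (M := Rmax M0 M1).
assert (HM : forall x, - L <= x <= L -> norm1_2 (Q x) <= M /\ norm1_2 (Qx x) <= M).
{ intros x Hx; split; [apply Rle_trans with M0 | apply Rle_trans with M1];
    auto; [apply Rmax_l | apply Rmax_r]. }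
assert (HMpos : 0 <= M).
{ destruct (HM 0 ltac:(lra)) as [HM2 _]; pose proof (norm1_2_ge_0 (Q 0)); lra. }
set (Y := M * B * (24 * L * (1 + M) * P + 7 * P)).
assert (HY : 0 <= Y).
{ assert (0 <= L * ((1 + M) * P)) by (apply Rmult_le_pos; [|apply Rmult_le_pos]; lra).
  apply Rmult_le_pos; [apply Rmult_le_pos|]; lra. }
assert (HYe : 0 <= Y / eps) by (apply Rmult_le_pos; [lra | left; now apply Rinv_0_lt_compat]).
assert (HML : 0 <= M * L) by now apply Rmult_le_pos.
(* The summands serve in turn: [z < q0]; positivity of [metric] for the backgrounds [qp] and [qm],
   and for [Q] on the segment; the smallness condition of length [2 * L]; and a WKB error
   [Y / (2 * k)] at most [eps]. *)
destruct (exists_large_kz q0 (q0 + 4 * norm1_2 qp + 4 * norm1_2 qm + 4 * M + 24 * (M * L) + Y / eps))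
  as [z [Hz Hk]]; [lra | lra |].
destruct (first_column_lim q0 sigma qp psip Hq0 Ap z Hz) as [a Ha].
pose proof (second_column_lim q0 sigma qm psim Hq0 Am z Hz) as Hm.
(* The nonvanishing of [h11] turns [beta2 = 0] into [h21 = 0]. *)
assert (HH : H z 1%nat 0%nat = RtoC 0).
{ destruct (Hrefl z (zdom_z q0 Hq0 z Hz)) as [_ [H00 [_ Hb]]].
  unfold beta2, cr in *.
  replace (H z 1%nat 0%nat) with (H z 1%nat 0%nat / H z 0%nat 0%nat * H z 0%nat 0%nat)%C
    by (field; exact H00).
  rewrite Hb; ring. }
pose proof (dotJ_scattering_zero q0 sigma q qx qxx qm psip psim H Sm Hq0 Lm Am Hsc z Hz HH (- L)) as Hzero.
set (k := kz q0 z) in *.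
assert (Hk0 : 0 < k) by lra.
set (psi := fun x : R => (fun i => a * psip z x 0 i 0%nat)%C : vec).
set (chi := fun x : R => (fun i => RtoC q0 * psim z x 0 i 1%nat)%C : vec).
set (wp := lambda_wave q0 z qp).
assert (Hpsi : forall x i, (i < 3)%nat ->
  is_derive (fun y => psi y i) x (mvmul (Xm k (Q x)) (psi x) i)).
{ apply (scal_solution (fun x => Xm k (Q x)) a (fun x i => psip z x 0 i 0%nat)).
  apply (column_solution q0 sigma q qx qxx Hq0 z Hz psip 0 Lp); lia. }
assert (Hchi : forall x i, (i < 3)%nat ->
  is_derive (fun y => chi y i) x (mvmul (Xm k (Q x)) (chi x) i)).
{ apply (scal_solution (fun x => Xm k (Q x)) (RtoC q0) (fun x i => psim z x 0 i 1%nat)).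
  apply (column_solution q0 sigma q qx qxx Hq0 z Hz psim 1 Lm); lia. }
assert (Rp : norm1 (vsub (psi L) (wp L)) <= eps).
{ pose proof (tail_p_infty k qp Q psi wp Ep Wp Hk0 ltac:(lra) Hpsi
    (fun x i Hi => lambda_wave_derive q0 z qp x i ltac:(lra) Hqp Hi)
    (norm1_lambda_wave_le q0 qp z Hz) DEp lp Ha Hlp L) as HR.
  replace (lp - Ep L) with (-1 * (Ep L - lp)) in HR by ring.
  pose proof (norm1_ge_0 (vsub (psi L) (wp L))); nra. }
assert (Rm : norm1 (vsub (chi (- L)) (plane_wave k c (- L))) <= eps).
{ pose proof (tail_m_infty k qm Q chi (plane_wave k c) Em B Hk0 ltac:(lra) Hchi
    (fun x i Hi => plane_wave_derive k qm x i Hi)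
    (fun x => Req_le _ _ (norm1_plane_wave k c x)) DEm lm Hm Hlm (- L)) as HR.
  replace (Em (- L) - lm) with (1 * (Em (- L) - lm)) in HR by ring.
  pose proof (norm1_ge_0 (vsub (chi (- L)) (plane_wave k c (- L)))); nra. }
assert (HPsi : norm1 (psi L) <= P).
{ pose proof (norm1_lambda_wave_le q0 qp z Hz L) as HW; fold wp Wp in HW.
  revert Rp HW; unfold norm1, vsub, P.
  assert (T : forall u v, Cmod u <= Cmod (u - v) + Cmod v).
  { intros u v; replace u with (u - v + v)%C at 1 by ring; apply Cmod_triangle. }
  pose proof (T (psi L 0%nat) (wp L 0%nat)); pose proof (T (psi L 1%nat) (wp L 1%nat)).
  pose proof (T (psi L 2%nat) (wp L 2%nat)); lra. }
assert (Hpair : dotJ (chi (- L)) (psi (- L)) = RtoC 0).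
{ transitivity (RtoC q0 * a * dotJ (fun i => psim z (- L)%R 0 i 1%nat) (fun i => psip z (- L)%R 0 i 0%nat))%C.
  - unfold dotJ, chi, psi; rewrite !Cmult_conj.
    replace (Cconj (RtoC q0)) with (RtoC q0) by (apply injective_projections; simpl; ring).
    ring.
  - rewrite Hzero; ring. }
pose proof (overlap_bound k L M P eps (lz q0 z * L) Q Qx psi c qp (wp L) (chi (- L))
  Hk0 HL0 ltac:(lra)) as HO.
assert (Hsmall : 12 * M / k * (L - - L) <= 1).
{ replace (12 * M / k * (L - - L)) with (24 * (M * L) / k) by (field; lra).
  apply Rdiv_le_of_mult_le; lra. }
specialize (HO Hsmall HM HQ Hpsi HPsi (fun j Hj => eq_refl) Rp Rm Hpair).
assert (HX : M * norm1_2 c / (2 * k) * (24 * L * (1 + M) * P + 7 * P) <= eps).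
{ fold B; replace (M * B / (2 * k) * (24 * L * (1 + M) * P + 7 * P)) with (Y / (2 * k))
    by (unfold Y; field; lra).
  apply Rdiv_le_of_mult_le; [lra|].
  assert (HYk : Y / eps <= 2 * k) by lra.
  apply (Rmult_le_compat_l eps) in HYk; [|lra].
  replace (eps * (Y / eps)) with Y in HYk by (field; lra); exact HYk. }
(* [D] is now at most [D / 2], although it is positive. *)
fold D B in HO; fold B in HX; lra.
Qed.
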